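(* Let $A$ be a real $n\times m$ matrix and let $(x^*,y^* )\in\Delta_n\times\Delta_m$ be a quasi-strict Nash equilibrium of the zero-sum bimatrix game $A$, with value $v_A$. Let $A_*$ be the submatrix of $A$ whose rows are restricted to $\operatorname{supp}(x^* )$ and whose columns are restricted to $\operatorname{supp}(y^* )$. Assume that $A_*$ is weakly $\mathcal{Z}_{|\operatorname{supp}(y^* )|}$-invertible and that $A_*^T$ is weakly $\mathcal{Z}_{|\operatorname{supp}(x^* )|}$-invertible. Let $\delta\in[0,1)$ and $C>0$ be constants (not depending on $h$). Then there is $h_0>0$ such that for every $h\in(0,h_0)$ for which $\epsilon:=Ch^{-\delta}$ satisfies $\epsilon<|v_A^{-1}|$ (with the convention $|v_A^{-1}|:=+\infty$ if $v_A=0$), there exists a neighborhood $U(h)\subset\Delta_n\times\Delta_m$ of $(x^*,y^* )$ such that for all $(x^0,y^0)\in U(h)$ the CMWU iterates $(x^{t+1},y^{t+1})=(\varphi_1(x^t,y^t),\varphi_2(x^t,y^t))$, $t\ge 0$, with parameters $h,\epsilon$, satisfy $$\lim_{t\to\infty}(\varphi_1(x^t,y^t),\varphi_2(x^t,y^t))=(x^*,y^* ).$$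
   Context: $\Delta_k\subset\mathbb{R}^k$ is the probability simplex (vectors with nonnegative coordinates summing to one). In the zero-sum bimatrix game $A\in\mathbb{R}^{n\times m}$, player 1 chooses $x\in\Delta_n$ and receives payoff $x^TAy$, player 2 chooses $y\in\Delta_m$ and receives payoff $-x^TAy$ (both maximize their own payoff). The value is $v_A:=x^{*T}Ay^*$ for any Nash equilibrium $(x^*,y^* )$ (it does not depend on the choice of equilibrium). A Nash equilibrium $(x^*,y^* )$ is quasi-strict if $[Ay^*]_i<v_A$ whenever $x_i^*=0$, and $[A^Tx^*]_j>v_A$ whenever $y_j^*=0$. $\operatorname{supp}(z)$ is the set of indices of nonzero entries of $z$. $\mathcal{Z}_k\subseteq\mathbb{R}^k$ is the subspace of vectors whose coordinates sum to zero. For a subspace $\mathcal{V}\subseteq\mathbb{R}^q$, a (possibly non-square) $p\times q$ matrix $M$ is weakly $\mathcal{V}$-invertible if $\ker(M)\cap\mathcal{V}=\{0\}$. For a vector $z$, $D_z:=\operatorname{diag}(z)$. The simplex-Hessians are $H_x:=A^TD_xA\in\mathbb{R}^{m\times m}$ and $H_y:=AD_yA^T\in\mathbb{R}^{n\times n}$, for $x\in\Delta_n$, $y\in\Delta_m$. For $h>0$ and $\epsilon>0$, the CMWU (Consensus Multiplicative Weights Update) map $(\varphi_1,\varphi_2):\Delta_n\times\Delta_m\to\Delta_n\times\Delta_m$ is, for $1\le i\le n$, $1\le j\le m$, $$[\varphi_1(x,y)]_i:=\frac{x_i\exp(h[Ay]_i-h\epsilon[H_yx]_i)}{\sum_{k=1}^n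 x_k\exp(h[Ay]_k-h\epsilon[H_yx]_k)},\qquad [\varphi_2(x,y)]_j:=\frac{y_j\exp(-h[A^Tx]_j-h\epsilon[H_xy]_j)}{\sum_{k=1}^m y_k\exp(-h[A^Tx]_k-h\epsilon[H_xy]_k)}.$$ *)

(* Defs.v *)
From HB Require Import structures.
From mathcomp Require Import all_boot all_order all_algebra.
From mathcomp Require Import all_classical all_reals all_analysis.
Set Implicit Arguments.
Unset Strict Implicit.
Unset Printing Implicit Defensive.
Import Order.TTheory GRing.Theory Num.Theory.
Import numFieldNormedType.Exports.
Local Open Scope classical_set_scope.
Local Open Scope ring_scope.

Definition simplex (R : realType) (k : nat) : set 'cV[R]_k :=
  [set z | (forall i, 0 <= z i 0) /\ \sum_i z i 0 = 1].

Arguments simplex : clear implicits.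

Section Games.
Variable R : realType.

Definition supp (k : nat) (z : 'cV[R]_k) : {set 'I_k} :=
  [set i | z i 0 != 0]%SET.

Definition zero_sum_space (k : nat) : {vspace 'cV[R]_k} :=
  lker (linfun (mulmx (const_mx 1 : 'rV[R]_k) : 'cV[R]_k -> 'M[R]_1)).

Definition weakly_invertible (p q : nat) (V : {vspace 'cV[R]_q})
    (M : 'M[R]_(p, q)) : Prop :=
  (lker (linfun (mulmx M : 'cV[R]_q -> 'cV[R]_p)) :&: V = 0)%VS.

Lemma mem_zero_sum_space (k : nat) (z : 'cV[R]_k) :
  z \in zero_sum_space k <-> \sum_i z i 0 = 0.
Proof.
rewrite memv_ker lfunE /=; split.
  move=> /eqP/matrixP/(_ 0 0); rewrite !mxE => s0; rewrite -[RHS]s0.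
  by apply: eq_bigr => i _; rewrite mxE mul1r.
move=> s0; apply/eqP/matrixP => i j; rewrite !ord1 !mxE -[RHS]s0.
by apply: eq_bigr => l _; rewrite mxE mul1r.
Qed.

Lemma weakly_invertibleP (p q : nat) (V : {vspace 'cV[R]_q})
    (M : 'M[R]_(p, q)) :
  weakly_invertible V M <-> (forall z, z \in V -> M *m z = 0 -> z = 0).
Proof.
split=> [MV z zV Mz|MV].
  by apply/eqP; rewrite -memv0 -MV memv_cap memv_ker lfunE /= Mz eqxx.
apply/eqP; rewrite -subv0; apply/subvP => z; rewrite memv_cap memv_ker lfunE /=.
by move=> /andP[/eqP Mz zV]; rewrite memv0 (MV z).
Qed.

Variables n m : nat.
Implicit Types (A : 'M[R]_(n, m)) (x : 'cV[R]_n) (y : 'cV[R]_m).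

(* Payoff of player 1; player 2 receives its opposite. *)
Definition payoff A x y : R := (x^T *m A *m y) 0 0.

Definition nash_equilibrium A x y : Prop :=
  [/\ simplex R n x, simplex R m y,
      forall x', simplex R n x' -> payoff A x' y <= payoff A x y &
      forall y', simplex R m y' -> - payoff A x y' <= - payoff A x y].

(* The payoff at an arbitrarily chosen equilibrium (0 if there is none); it
   does not depend on the choice, see [game_valueE]. *)
Definition game_value A : R :=
  xget 0 [set v | exists x y, nash_equilibrium A x y /\ v = payoff A x y].

Lemma game_valueE A x y : nash_equilibrium A x y -> game_value A = payoff A x y.
Proof.
move=> xy; rewrite /game_value; case: xgetP => [v _|/(_ (payoff A x y))].
  move=> [x' [y' [xy' ->]]].
  have [sx sy ex ey] := xy; have [sx' sy' ex' ey'] := xy'.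
  apply/eqP; rewrite eq_le; apply/andP; split.
    have := ey' _ sy; rewrite lerN2 => /le_trans; apply; exact: ex.
  have := ey _ sy'; rewrite lerN2 => /le_trans; apply; exact: ex'.
by case; exists x, y.
Qed.

Definition quasi_strict A x y : Prop :=
  [/\ nash_equilibrium A x y,
      forall i, x i 0 = 0 -> (A *m y) i 0 < game_value A &
      forall j, y j 0 = 0 -> game_value A < (A^T *m x) j 0].

Definition supp_submx A x y : 'M[R]_(#|supp x|, #|supp y|) :=
  mxsub (@enum_val _ (mem (supp x))) (@enum_val _ (mem (supp y))) A.

Definition hessian_x A x : 'M[R]_m := A^T *m diag_mx x^T *m A.

Definition hessian_y A y : 'M[R]_n := A *m diag_mx y^T *m A^T.

Definition cmwu_weight1 A (h eps : R) x y (i : 'I_n) : R :=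
  x i 0 * expR (h * (A *m y) i 0 - h * eps * (hessian_y A y *m x) i 0).

Definition cmwu_weight2 A (h eps : R) x y (j : 'I_m) : R :=
  y j 0 * expR (- h * (A^T *m x) j 0 - h * eps * (hessian_x A x *m y) j 0).

Definition cmwu1 A (h eps : R) x y : 'cV[R]_n :=
  \col_i (cmwu_weight1 A h eps x y i / \sum_k cmwu_weight1 A h eps x y k).

Definition cmwu2 A (h eps : R) x y : 'cV[R]_m :=
  \col_j (cmwu_weight2 A h eps x y j / \sum_k cmwu_weight2 A h eps x y k).

End Games.

Lemma simplex_normalize (R : realType) (k : nat) (z e : 'cV[R]_k) :
  simplex R k z -> (forall i, 0 < e i 0) ->
  simplex R k (\col_i (z i 0 * e i 0 / \sum_l z l 0 * e l 0)).
Proof.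
move=> [z0 z1] e0.
have w0 i : 0 <= z i 0 * e i 0 by rewrite mulr_ge0 // ltW.
have S0 : 0 <= \sum_l z l 0 * e l 0 by apply: sumr_ge0.
split=> [i|]; first by rewrite mxE divr_ge0.
under eq_bigr do rewrite mxE.
rewrite -mulr_suml divff //; apply/eqP => /psumr_eq0P H.
have zE i : z i 0 = 0.
  by have /eqP := H (fun i _ => w0 i) i isT; rewrite mulf_eq0 (gt_eqF (e0 i)) orbF => /eqP.
by move/eqP: z1; rewrite big1 ?(eq_sym 0) ?oner_eq0.
Qed.

(* The map (cmwu1, cmwu2), defined on all pairs of vectors, preserves the
   product of the simplices. *)
Lemma cmwu_simplex (R : realType) (n m : nat) (A : 'M[R]_(n, m)) (h eps : R)
    (x : 'cV[R]_n) (y : 'cV[R]_m) :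
  simplex R n x -> simplex R m y ->
  simplex R n (cmwu1 A h eps x y) /\ simplex R m (cmwu2 A h eps x y).
Proof.
move=> sx sy; split.
- pose e : 'cV[R]_n := \col_i expR (h * (A *m y) i 0
    - h * eps * (hessian_y A y *m x) i 0).
  have eE i : x i 0 * e i 0 = cmwu_weight1 A h eps x y i by rewrite mxE.
  have -> : cmwu1 A h eps x y =
      \col_i (x i 0 * e i 0 / \sum_l x l 0 * e l 0).
    by apply/colP => i; rewrite mxE [RHS]mxE eE; under [in RHS]eq_bigr do rewrite eE.
  by apply: simplex_normalize => // i; rewrite mxE expR_gt0.
- pose e : 'cV[R]_m := \col_j expR (- h * (A^T *m x) j 0
    - h * eps * (hessian_x A x *m y) j 0).
  have eE j : y j 0 * e j 0 = cmwu_weight2 A h eps x y j by rewrite mxE.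
  have -> : cmwu2 A h eps x y =
      \col_j (y j 0 * e j 0 / \sum_l y l 0 * e l 0).
    by apply/colP => j; rewrite mxE [RHS]mxE eE; under [in RHS]eq_bigr do rewrite eE.
  by apply: simplex_normalize => // j; rewrite mxE expR_gt0.
Qed.

(* Main.v *)
(* Subtracting the value v from the payoffs turns CMWU into the exponential
   weights scheme with exponents
     h (1 - eps v) B y - h eps B D_y B^T x      for player 1,
   - h (1 + eps v) B^T x - h eps B^T D_x B y    for player 2,   B = A - v 11^T,
   so that the weighted relative entropy
     V = (1 + eps v) KL(xs|x) + (1 - eps v) KL(ys|y)
   makes the bilinear cross terms of the two players cancel.  By
   exp g <= 1 + g + 2 g^2, close to the equilibrium and for h small, V drops in
   each step by at least a multiple of
     (payoff slack of the pure strategies outside the supports)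
     + sum_j y_j (A^T (x - xs))_j^2 + sum_i x_i (A (y - ys))_i^2,
   the quadratic errors, of order h^2 and (h eps)^2, being absorbed by the terms
   of order h and h eps.  Hence this quantity tends to 0 along the orbit.
   Quasi-strictness then kills the mass outside the supports, and weak
   invertibility turns A^T (x - xs) -> 0 and A (y - ys) -> 0 on the supports into
   x -> xs and y -> ys. *)

Require Import Defs.
From HB Require Import structures.
From mathcomp Require Import all_boot all_order all_algebra.
From mathcomp Require Import ring lra.
From mathcomp Require Import all_classical all_reals all_analysis.
Set Implicit Arguments.
Unset Strict Implicit.
Unset Printing Implicit Defensive.
Import Order.TTheory GRing.Theory Num.Theory.
Import numFieldNormedType.Exports.
Local Open Scope classical_set_scope.
Local Open Scope ring_scope.

(** * Relative entropy under exponential weights *)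

(** Inverting [exp(-g) >= 1 - g] gives [exp g <= 1 / (1 - g)], and [(1 + g + 2 g^2)(1 - g) = 1 + g^2
    (1 - 2 g)]. *)
Lemma expR_le_quadratic (R : realType) (g : R) :
  `|g| <= 1 / 2 -> expR g <= 1 + g + 2 * g ^+ 2.
Proof.
rewrite ler_norml => /andP[g1 g2].
have e1 : 1 - g <= expR (- g) by rewrite expR_ge1Dx.
have g0 : 0 < 1 - g by lra.
have -> : expR g = (expR (- g))^-1 by rewrite expRN invrK.
apply: (@le_trans _ _ (1 - g)^-1); first by rewrite lef_pV2 ?posrE ?expR_gt0.
rewrite -[leLHS]mul1r ler_pdivrMr //.
have : 0 <= g ^+ 2 * (1 - 2 * g) by rewrite mulr_ge0 ?sqr_ge0 //; lra.
lra.
Qed.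

Lemma ln_leB1 (R : realType) (u : R) : 0 < u -> ln u <= u - 1.
Proof.
move=> u0; have := @le_ln1Dx R (u - 1).
have -> : 1 + (u - 1) = u by ring.
by apply; lra.
Qed.

Section RelativeEntropy.
Variables (R : realType) (k : nat).
Implicit Types p x y g : 'cV[R]_k.

(** Where [x] vanishes and [p] does not, this total form is not the relative entropy, so the bounds
    below ask for [x] positive on the support of [p]. *)
Definition kl p x : R := \sum_i p i 0 * (ln (p i 0) - ln (x i 0)).

Definition exp_weights x g : 'cV[R]_k :=
  \col_i (x i 0 * expR (g i 0) / \sum_l x l 0 * expR (g l 0)).

Lemma simplex_le1 x i : simplex R k x -> x i 0 <= 1.
Proof.
move=> [x0 <-]; rewrite (bigD1 i) //= lerDl.
by apply: sumr_ge0.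
Qed.

Lemma simplex_sumC x (c : R) : simplex R k x -> \sum_i x i 0 * c = c.
Proof. by move=> [_ x1]; rewrite -mulr_suml x1 mul1r. Qed.

Lemma sum_simplexB x y :
  simplex R k x -> simplex R k y -> \sum_i (x - y) i 0 = 0.
Proof.
move=> sx sy; rewrite -[RHS](subrr 1) -{1}sx.2 -sy.2 -sumrB.
by apply: eq_bigr => i _; rewrite !mxE.
Qed.

Lemma exp_weights_sum_gt0 x g :
  simplex R k x -> 0 < \sum_l x l 0 * expR (g l 0).
Proof.
move=> [x0 x1]; rewrite lt0r sumr_ge0 ?andbT; last first.
  by move=> i _; rewrite mulr_ge0 ?expR_ge0.
apply/eqP => /psumr_eq0P H; move/eqP: x1.
rewrite big1 ?(eq_sym 0) ?oner_eq0 // => i _.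
have /eqP := H (fun i _ => mulr_ge0 (x0 i) (expR_ge0 _)) i isT.
by rewrite mulf_eq0 (gt_eqF (expR_gt0 _)) orbF => /eqP.
Qed.

Lemma exp_weights_gt0 x g i :
  simplex R k x -> 0 < x i 0 -> 0 < exp_weights x g i 0.
Proof.
by move=> sx xi; rewrite mxE divr_gt0 ?mulr_gt0 ?expR_gt0 ?exp_weights_sum_gt0.
Qed.

(** Normalization makes the change of entropy exactly [ln Z - <p, g>]; then [ln Z <= Z - 1] and the
    quadratic bound on the exponential apply. *)
Lemma kl_exp_weights p x g :
  simplex R k p -> simplex R k x ->
  (forall i, p i 0 != 0 -> 0 < x i 0) -> (forall i, `|g i 0| <= 1 / 2) ->
  kl p (exp_weights x g) - kl p x <=
    \sum_i (x i 0 - p i 0) * g i 0 + 2 * \sum_i x i 0 * g i 0 ^+ 2.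
Proof.
move=> sp sx px g2; set Z := \sum_l x l 0 * expR (g l 0).
have Z0 : 0 < Z by exact: exp_weights_sum_gt0.
have -> : kl p (exp_weights x g) - kl p x = ln Z - \sum_i p i 0 * g i 0.
  rewrite -(simplex_sumC (ln Z) sp) /kl -!sumrB; apply: eq_bigr => i _.
  have [->|/px xi] := eqVneq (p i 0) 0; first by rewrite !mul0r subrr.
  rewrite mxE -/Z ln_div ?posrE ?mulr_gt0 ?expR_gt0 // lnM ?posrE ?expR_gt0 //.
  rewrite expRK; ring.
have lnZ : ln Z <= Z - 1 by exact: ln_leB1.
have ZE : Z <= 1 + \sum_i x i 0 * g i 0 + 2 * \sum_i x i 0 * g i 0 ^+ 2.
  rewrite -{1}(simplex_sumC 1 sx) mulr_sumr -!big_split; apply: ler_sum => i _ /=.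
  have := ler_wpM2l (sx.1 i) (expR_le_quadratic (g2 i)); lra.
have -> : \sum_i (x i 0 - p i 0) * g i 0 =
    \sum_i x i 0 * g i 0 - \sum_i p i 0 * g i 0.
  by rewrite -sumrB; apply: eq_bigr => i _; rewrite mulrBl.
lra.
Qed.

(* Since sum p = sum x, KL is also the sum of the nonnegative terms
   p ln (p / x) - p + x, each of which dominates (sqrt x - sqrt p)^2. *)
Lemma kl_ge p x i :
  simplex R k p -> simplex R k x -> (forall i, p i 0 != 0 -> 0 < x i 0) ->
  (x i 0 - p i 0) ^+ 2 <= 4 * kl p x.
Proof.
move=> sp sx px.
pose t j := p j 0 * (ln (p j 0) - ln (x j 0)) - p j 0 + x j 0.
have -> : kl p x = \sum_j t j.
  by rewrite /t big_split sumrB /= sp.2 sx.2 subrK.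
have tge j : (Num.sqrt (x j 0) - Num.sqrt (p j 0)) ^+ 2 <= t j.
  have xE := sqr_sqrtr (sx.1 j); have pE := sqr_sqrtr (sp.1 j).
  rewrite /t; have [p0|pj] := eqVneq (p j 0) 0.
    by rewrite p0 mul0r sqrtr0 !subr0 xE add0r.
  have xj := px _ pj.
  have {}pj : 0 < p j 0 by rewrite lt0r pj sp.1.
  set a := Num.sqrt (p j 0) in pE *; set b := Num.sqrt (x j 0) in xE *.
  have a0 : 0 < a by rewrite sqrtr_gt0.
  have b0 : 0 < b by rewrite sqrtr_gt0.
  (* Multiplied by [2 a^2], this gives [t j >= a^2 - 2 a b + b^2]. *)
  have : ln b - ln a <= b / a - 1.
    by rewrite -ln_div ?posrE // ln_leB1 ?divr_gt0.
  move=> /(ler_wpM2l (sqr_ge0 a)).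
  have -> : a ^+ 2 * (b / a - 1) = a * b - a ^+ 2 by field; exact: lt0r_neq0.
  rewrite -xE -pE !lnXn // !mulr2n; lra.
have t0 j : 0 <= t j by apply: le_trans (tge j); exact: sqr_ge0.
apply: (@le_trans _ _ (4 * t i)); last first.
  by rewrite ler_wpM2l // (bigD1 i) //= lerDl sumr_ge0.
(* The factor 4 bounds [(b + a)^2], as square roots of probabilities are at most 1. *)
apply: le_trans (ler_wpM2l (ler0n _ 4) (tge i)).
have xE := sqr_sqrtr (sx.1 i); have pE := sqr_sqrtr (sp.1 i).
rewrite -[in leLHS]xE -[in leLHS]pE.
set a := Num.sqrt (p i 0); set b := Num.sqrt (x i 0).
have a1 : a <= 1 by rewrite -sqrtr1 ler_wsqrtr ?simplex_le1.
have b1 : b <= 1 by rewrite -sqrtr1 ler_wsqrtr ?simplex_le1.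
have a0 : 0 <= a by exact: sqrtr_ge0.
have b0 : 0 <= b by exact: sqrtr_ge0.
have -> : b ^+ 2 - a ^+ 2 = (b + a) * (b - a) by ring.
rewrite exprMn ler_wpM2r ?sqr_ge0 //.
have -> : 4 = 2 ^+ 2 :> R by rewrite -natrX.
by rewrite ler_pXn2r ?nnegrE //; lra.
Qed.

Lemma kl_ge0 p x : simplex R k p -> simplex R k x ->
  (forall i, p i 0 != 0 -> 0 < x i 0) -> 0 <= kl p x.
Proof.
move=> sp sx px; have [i|] := pickP 'I_k.
  by move=> _; have := kl_ge i sp sx px; have := sqr_ge0 (x i 0 - p i 0); lra.
by move=> k0; rewrite /kl big1 // => i; have := k0 i.
Qed.

Lemma kl_refl p : kl p p = 0.
Proof. by rewrite /kl big1 // => i _; rewrite subrr mulr0. Qed.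

End RelativeEntropy.

(** * One-player drift *)

Section MatrixBounds.
Variable R : realType.

(** A crude norm that dominates entries and row sums and ignores transposition and sign, so one
    constant serves both players. *)
Definition mx_l1 (p q : nat) (M : 'M[R]_(p, q)) : R := \sum_i \sum_j `|M i j|.

Lemma mx_l1_tr p q (M : 'M[R]_(p, q)) : mx_l1 M^T = mx_l1 M.
Proof.
rewrite /mx_l1 exchange_big; apply: eq_bigr => i _; apply: eq_bigr => j _.
by rewrite mxE.
Qed.

Lemma mx_l1N p q (M : 'M[R]_(p, q)) : mx_l1 (- M) = mx_l1 M.
Proof. by apply: eq_bigr => i _; apply: eq_bigr => j _; rewrite mxE normrN. Qed.

Lemma mx_l1_ge0 p q (M : 'M[R]_(p, q)) : 0 <= mx_l1 M.
Proof. by apply: sumr_ge0 => i _; apply: sumr_ge0. Qed.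

Lemma mx_l1_row p q (M : 'M[R]_(p, q)) i : \sum_j `|M i j| <= mx_l1 M.
Proof.
rewrite /mx_l1 (bigD1 i) //= lerDl; apply: sumr_ge0 => l _.
by apply: sumr_ge0.
Qed.

Lemma mx_l1_coef p q (M : 'M[R]_(p, q)) i j : `|M i j| <= mx_l1 M.
Proof.
apply: le_trans (mx_l1_row M i); rewrite (bigD1 j) //= lerDl.
by apply: sumr_ge0.
Qed.

Lemma norm_mulmx_le p q (M : 'M[R]_(p, q)) (z : 'cV[R]_q) (c : R) i :
  (forall j, `|z j 0| <= c) -> `|(M *m z) i 0| <= mx_l1 M * c.
Proof.
move=> zc; rewrite mxE; apply: le_trans (ler_norm_sum _ _ _) _.
have [c0|c0] := leP 0 c.
  apply: le_trans (ler_wpM2r c0 (mx_l1_row M i)); rewrite mulr_suml.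
  by apply: ler_sum => j _; rewrite normrM ler_wpM2l.
(* No absolute value lies below a negative [c]: there are no columns and both sides are 0. *)
rewrite big1; last first.
  by move=> j _; have := le_trans (normr_ge0 _) (zc j); rewrite leNgt c0.
have [j _|q0] := pickP 'I_q.
  by have := le_trans (normr_ge0 _) (zc j); rewrite leNgt c0.
rewrite /mx_l1 big1 ?mul0r // => l _; apply: big1 => j.
by have := q0 j.
Qed.

Lemma simplex_abs k (z : 'cV[R]_k) i : simplex R k z -> `|z i 0| <= 1.
Proof. by move=> sz; rewrite ger0_norm ?simplex_le1 //; exact: sz.1. Qed.

Lemma sum_mulmx_tr p q (M : 'M[R]_(p, q)) (u : 'cV[R]_p) (z : 'cV[R]_q) :
  \sum_i u i 0 * (M *m z) i 0 = \sum_j z j 0 * (M^T *m u) j 0.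
Proof.
under eq_bigr do rewrite mxE mulr_sumr.
rewrite exchange_big; apply: eq_bigr => j _ /=; rewrite mxE mulr_sumr.
by apply: eq_bigr => i _; rewrite mxE; ring.
Qed.

Lemma diag_mulmx k (d z : 'cV[R]_k) i :
  (diag_mx d^T *m z) i 0 = d i 0 * z i 0.
Proof. by rewrite mul_diag_mx mxE mxE. Qed.

(** The difference of the two sides is the variance of [c] under [d]. *)
Lemma simplex_jensen k (d : 'cV[R]_k) (c : 'I_k -> R) : simplex R k d ->
  (\sum_i d i 0 * c i) ^+ 2 <= \sum_i d i 0 * c i ^+ 2.
Proof.
move=> sd; set mu := \sum_i _.
have : 0 <= \sum_i d i 0 * (c i - mu) ^+ 2.
  by apply: sumr_ge0 => i _; rewrite mulr_ge0 ?sqr_ge0 ?sd.1.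
have -> : \sum_i d i 0 * (c i - mu) ^+ 2 =
    \sum_i d i 0 * c i ^+ 2 - mu * (2 * mu) + \sum_i d i 0 * mu ^+ 2.
  have -> : mu * (2 * mu) = \sum_i d i 0 * c i * (2 * mu) by rewrite -mulr_suml.
  rewrite -sumrB -big_split; apply: eq_bigr => i _ /=; ring.
rewrite simplex_sumC //; lra.
Qed.

End MatrixBounds.

(** * Exponents of one player and their first- and second-order effect *)

Section Drift.
Variables (R : realType) (n m : nat).
Implicit Types (B : 'M[R]_(n, m)) (x xs : 'cV[R]_n) (y ys : 'cV[R]_m).

(** For the shifted matrix [B], this is the CMWU exponent of player 1 up to an additive constant;
    player 2 is the instance [- B^T], with [be] in place of [al]. *)
Definition exponent B (h al eps : R) x y : 'cV[R]_n :=
  (h * al) *: (B *m y) - (h * eps) *: (B *m (diag_mx y^T *m (B^T *m x))).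

Lemma exponentE B (h al eps : R) x y i :
  exponent B h al eps x y i 0 = h * al * (B *m y) i 0
    - h * eps * (B *m (diag_mx y^T *m (B^T *m x))) i 0.
Proof. by rewrite !mxE. Qed.

(** Brings the exponents into the range where the quadratic bound on the exponential holds; each of
    the two terms is at most 1/32. *)
Lemma exponent_le B (h al eps : R) x y i :
  simplex R n x -> simplex R m y -> 0 <= h -> 0 <= al -> 0 <= eps ->
  32 * h * al * mx_l1 B <= 1 -> 32 * h * eps * mx_l1 B ^+ 2 <= 1 ->
  `|exponent B h al eps x y i 0| <= 1 / 2.
Proof.
move=> sx sy h0 al0 eps0 h1 h2; rewrite exponentE.
have e1 : `|(h * al) * (B *m y) i 0| <= 1 / 32.
  rewrite normrM ger0_norm ?mulr_ge0 //.
  have := norm_mulmx_le B i (fun j => simplex_abs j sy).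
  by move=> /(ler_wpM2l (mulr_ge0 h0 al0)); lra.
have e2 : `|(h * eps) * (B *m (diag_mx y^T *m (B^T *m x))) i 0| <= 1 / 32.
  rewrite normrM ger0_norm ?mulr_ge0 //.
  have : `|(B *m (diag_mx y^T *m (B^T *m x))) i 0| <= mx_l1 B * mx_l1 B.
    apply: norm_mulmx_le => j; rewrite diag_mulmx normrM.
    have := norm_mulmx_le B^T j (fun l => simplex_abs l sx).
    rewrite mx_l1_tr mulr1 => le1.
    by rewrite -[leRHS]mul1r ler_pM // simplex_abs.
  by move=> /(ler_wpM2l (mulr_ge0 h0 eps0)); lra.
have := ler_normB ((h * al) * (B *m y) i 0)
  ((h * eps) * (B *m (diag_mx y^T *m (B^T *m x))) i 0).
lra.
Qed.

Section Estimate.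
Variables (B : 'M[R]_(n, m)) (h al eps : R).
Variables (x xs : 'cV[R]_n) (y ys : 'cV[R]_m).
Hypotheses (sx : simplex R n x) (sy : simplex R m y) (sys : simplex R m ys).

(** [a] and [b] are payoff deviations. As the shifted game has value 0, [r] and [s] are the slacks
    of the pure strategies at equilibrium, and [rho], [sigma] their averages at the current
    point. *)
Let a := B^T *m (x - xs).
Let b := B *m (y - ys).
Let r := - (B *m ys).
Let s := B^T *m xs.
Let K := mx_l1 B.
Let g := exponent B h al eps x y.
Let sigma := \sum_j y j 0 * s j 0.
Let rho := \sum_i x i 0 * r i 0.

Hypotheses (r0 : forall i, 0 <= r i 0) (s0 : forall j, 0 <= s j 0).
Hypothesis xsr : forall i, xs i 0 * r i 0 = 0.

(** Writing [B^T x = a + s] splits the Hessian term [B D_y B^T x] into [p + q]. *)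
Let p i := \sum_j y j 0 * (B i j * a j 0).
Let q i := \sum_j B i j * (y j 0 * s j 0).

Let gE i : g i 0 = h * al * b i 0 - h * al * r i 0 - h * eps * p i - h * eps * q i.
Proof.
have -> : g i 0 = h * al * (b i 0 - r i 0) -
    h * eps * (B *m (diag_mx y^T *m (B^T *m x))) i 0.
  have -> : b i 0 - r i 0 = (B *m y) i 0.
    by rewrite /b /r mulmxBr !mxE; ring.
  by rewrite /g exponentE.
have -> : (B *m (diag_mx y^T *m (B^T *m x))) i 0 = p i + q i.
  rewrite /p /q -big_split [LHS]mxE; apply: eq_bigr => j _ /=.
  rewrite diag_mulmx.
  have -> : (B^T *m x) j 0 = a j 0 + s j 0.
    by rewrite /a /s mulmxBr !mxE; ring.
  ring.
ring.
Qed.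

(** Moving [B] across the pairing turns the Hessian term into [<a, D_y (a + s)>], whose part
    [sum y a^2] is the friction; complementary slackness turns [<x - xs, r>] into [rho]. *)
Let linear_part : \sum_i (x i 0 - xs i 0) * g i 0 =
  h * al * \sum_i (x i 0 - xs i 0) * b i 0 - h * al * rho
  - h * eps * \sum_j y j 0 * a j 0 ^+ 2
  - h * eps * \sum_j y j 0 * (a j 0 * s j 0).
Proof.
have -> : rho = \sum_i (x i 0 - xs i 0) * r i 0.
  by apply: eq_bigr => i _; rewrite mulrBl xsr subr0.
pose w : 'cV[R]_m := \col_j (y j 0 * (a j 0 + s j 0)).
have wE i : (B *m w) i 0 = p i + q i.
  rewrite /p /q -big_split [LHS]mxE; apply: eq_bigr => j _ /=.
  by rewrite mxE; ring.
have : \sum_i (x - xs) i 0 * (B *m w) i 0 = \sum_j w j 0 * a j 0.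
  exact: sum_mulmx_tr.
have -> : \sum_j w j 0 * a j 0 =
    \sum_j y j 0 * a j 0 ^+ 2 + \sum_j y j 0 * (a j 0 * s j 0).
  by rewrite -big_split; apply: eq_bigr => j _ /=; rewrite mxE; ring.
move=> E; rewrite -addrA -opprD -mulrDr -E !mulr_sumr -!sumrB.
by apply: eq_bigr => i _; rewrite gE wE !mxE; ring.
Qed.

Let quadratic_part : \sum_i x i 0 * g i 0 ^+ 2 <=
  4 * ((h * al) ^+ 2 * \sum_i x i 0 * b i 0 ^+ 2
     + (h * al) ^+ 2 * \sum_i x i 0 * r i 0 ^+ 2
     + (h * eps * K) ^+ 2 * \sum_j y j 0 * a j 0 ^+ 2
     + (h * eps * K) ^+ 2 * sigma ^+ 2).
Proof.
set Sa := \sum_j y j 0 * a j 0 ^+ 2.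
have K0 : 0 <= K by exact: mx_l1_ge0.
have sigma0 : 0 <= sigma by apply: sumr_ge0 => j _; rewrite mulr_ge0 ?sy.1.
(* Jensen with weights [y] bounds [p] by the friction sum itself, so this error can be absorbed. *)
have pK i : p i ^+ 2 <= K ^+ 2 * Sa.
  apply: le_trans (simplex_jensen _ sy) _; rewrite mulr_sumr.
  apply: ler_sum => j _; rewrite exprMn mulrCA ler_wpM2r //.
    by rewrite mulr_ge0 ?sqr_ge0 ?sy.1.
  by rewrite -real_normK ?num_real // ler_pXn2r ?nnegrE ?mx_l1_coef.
have qK i : q i ^+ 2 <= K ^+ 2 * sigma ^+ 2.
  rewrite -exprMn -[leLHS]real_normK ?num_real //.
  rewrite ler_pXn2r ?nnegrE ?mulr_ge0 // /sigma mulr_sumr.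
  apply: le_trans (ler_norm_sum _ _ _) _; apply: ler_sum => j _.
  rewrite normrM (ger0_norm (mulr_ge0 (sy.1 j) (s0 j))).
  by rewrite ler_wpM2r ?mx_l1_coef // mulr_ge0 ?sy.1.
apply: (@le_trans _ _ (\sum_i (4 * (h * al) ^+ 2 * (x i 0 * b i 0 ^+ 2)
   + 4 * (h * al) ^+ 2 * (x i 0 * r i 0 ^+ 2)
   + x i 0 * (4 * (h * eps) ^+ 2 * (K ^+ 2 * Sa + K ^+ 2 * sigma ^+ 2))))).
  apply: ler_sum => i _.
  have -> : 4 * (h * al) ^+ 2 * (x i 0 * b i 0 ^+ 2)
     + 4 * (h * al) ^+ 2 * (x i 0 * r i 0 ^+ 2)
     + x i 0 * (4 * (h * eps) ^+ 2 * (K ^+ 2 * Sa + K ^+ 2 * sigma ^+ 2))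
    = x i 0 * (4 * ((h * al * b i 0) ^+ 2 + (h * al * r i 0) ^+ 2
        + (h * eps) ^+ 2 * (K ^+ 2 * Sa + K ^+ 2 * sigma ^+ 2))) by ring.
  rewrite ler_wpM2l ?sx.1 //.
  have pq : (h * eps * p i) ^+ 2 + (h * eps * q i) ^+ 2
     <= (h * eps) ^+ 2 * (K ^+ 2 * Sa + K ^+ 2 * sigma ^+ 2).
    by rewrite !exprMn -mulrDr ler_wpM2l ?lerD // mulr_ge0 ?sqr_ge0.
  rewrite gE; apply: le_trans (ler_wpM2l (ler0n _ 4) (lerD (lexx _) pq)).
  set u1 := h * al * b i 0; set u2 := h * al * r i 0.
  set u3 := h * eps * p i; set u4 := h * eps * q i.
  (* This sum of squares equals [4 (u1^2 + u2^2 + u3^2 + u4^2) - (u1 - u2 - u3 - u4)^2]. *)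
  have : 0 <= (u1 + u2) ^+ 2 + (u1 + u3) ^+ 2 + (u1 + u4) ^+ 2
     + (u2 - u3) ^+ 2 + (u2 - u4) ^+ 2 + (u3 - u4) ^+ 2.
    by rewrite !addr_ge0 ?sqr_ge0.
  lra.
rewrite !big_split /= simplex_sumC // -!mulr_sumr; lra.
Qed.

Hypotheses (h0 : 0 <= h) (al0 : 0 <= al) (eps0 : 0 <= eps).

(** Each error costs a quarter of a main term: [rho] and the friction lose one quarter each, while
    [sigma] collects two, from the products [a s] and from [sigma ^+ 2]. The terms in [sigma] and in
    [x b^2] are left to be paid by the drift of the other player. *)
Lemma drift_le :
  32 * h * al * K <= 1 -> 32 * h * eps * K ^+ 2 <= 1 ->
  (forall j, 4 * eps * `|a j 0| <= al) ->
  32 * h * eps ^+ 2 * K ^+ 2 * sigma <= al ->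
  \sum_i (x i 0 - xs i 0) * g i 0 + 2 * \sum_i x i 0 * g i 0 ^+ 2 <=
    h * al * \sum_i (x i 0 - xs i 0) * b i 0
    - 3 / 4 * h * al * rho + 1 / 2 * h * al * sigma
    - 3 / 4 * h * eps * \sum_j y j 0 * a j 0 ^+ 2
    + 8 * (h * al) ^+ 2 * \sum_i x i 0 * b i 0 ^+ 2.
Proof.
move=> c1 c2 c3 c4.
rewrite linear_part.
have sigma0 : 0 <= sigma by apply: sumr_ge0 => j _; rewrite mulr_ge0 ?sy.1.
have rho0 : 0 <= rho by apply: sumr_ge0 => j _; rewrite mulr_ge0 ?sx.1.
have K0 : 0 <= K by exact: mx_l1_ge0.
have e1 : - (h * eps * \sum_j y j 0 * (a j 0 * s j 0)) <= h * al * (sigma / 4).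
  rewrite -mulrN -mulrA -mulrA ler_wpM2l // -sumrN /sigma mulr_suml !mulr_sumr.
  apply: ler_sum => j _.
  have : - a j 0 <= `|a j 0| by rewrite -normrN ler_norm.
  move=> /(ler_wpM2l eps0) aj; have {aj}: - (eps * a j 0) <= al / 4.
    by have := c3 j; lra.
  move=> /(ler_wpM2l (mulr_ge0 (sy.1 j) (s0 j))); lra.
have Sa0 : 0 <= \sum_j y j 0 * a j 0 ^+ 2.
  by apply: sumr_ge0 => j _; rewrite mulr_ge0 ?sqr_ge0 ?sy.1.
have e2 : 8 * ((h * eps * K) ^+ 2 * \sum_j y j 0 * a j 0 ^+ 2) <=
    h * eps * (\sum_j y j 0 * a j 0 ^+ 2) / 4.
  have := ler_wpM2r (mulr_ge0 (mulr_ge0 h0 eps0) Sa0) c2; lra.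
have e3 : 8 * ((h * al) ^+ 2 * \sum_i x i 0 * r i 0 ^+ 2) <= h * al * (rho / 4).
  have : \sum_i x i 0 * r i 0 ^+ 2 <= K * rho.
    rewrite /rho mulr_sumr; apply: ler_sum => i _.
    have rK : r i 0 <= K.
      have := norm_mulmx_le B i (fun j => simplex_abs j sys).
      by rewrite mulr1; apply: le_trans; rewrite /r mxE -normrN ler_norm.
    have := ler_wpM2r (mulr_ge0 (sx.1 i) (r0 i)) rK; lra.
  move=> /(ler_wpM2l (sqr_ge0 (h * al))).
  have := ler_wpM2r (mulr_ge0 (mulr_ge0 h0 al0) rho0) c1; lra.
have e4 : 8 * ((h * eps * K) ^+ 2 * sigma ^+ 2) <= h * al * (sigma / 4).
  have := ler_wpM2r (mulr_ge0 h0 sigma0) c4; lra.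
have := quadratic_part; lra.
Qed.

End Estimate.

End Drift.

(** * Payoff shift, equilibria and weak invertibility *)

Section PayoffShift.
Variables (R : realType) (n m : nat).
Implicit Types (A B : 'M[R]_(n, m)) (x : 'cV[R]_n) (y : 'cV[R]_m).

Lemma exp_weights_shift k (x g g' : 'cV[R]_k) (c : R) :
  (forall i, g' i 0 = g i 0 + c) -> exp_weights x g' = exp_weights x g.
Proof.
move=> gE; apply/colP => i; rewrite !mxE.
under eq_bigr do rewrite gE expRD mulrA.
by rewrite -mulr_suml gE expRD mulrA -mulf_div divff ?mulr1 // gt_eqF ?expR_gt0.
Qed.

Lemma mulmx_subC p q (M : 'M[R]_(p, q)) (v : R) (z : 'cV[R]_q) i :
  ((M - const_mx v) *m z) i 0 = (M *m z) i 0 - v * \sum_j z j 0.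
Proof.
rewrite !mxE mulr_sumr -sumrB; apply: eq_bigr => j _.
by rewrite !mxE mulrBl.
Qed.

Lemma trmx_subC p q (M : 'M[R]_(p, q)) (v : R) :
  (M - const_mx v)^T = M^T - const_mx v.
Proof. by apply/matrixP => i j; rewrite !mxE. Qed.

(* On the simplices, subtracting the constant v from A only rescales the
   first-order part of the exponent by 1 - eps * v, up to an additive constant
   which the normalization cancels. *)
Lemma cmwu1E A (h eps v : R) x y : simplex R n x -> simplex R m y ->
  cmwu1 A h eps x y =
  exp_weights x (exponent (A - const_mx v) h (1 - eps * v) eps x y).
Proof.
move=> sx sy; set B := A - const_mx v.
have AE (z : 'cV[R]_m) i : (A *m z) i 0 = (B *m z) i 0 + v * \sum_j z j 0.
  by rewrite mulmx_subC subrK.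
have ATE j : (A^T *m x) j 0 = (B^T *m x) j 0 + v.
  by rewrite trmx_subC mulmx_subC sx.2 mulr1 subrK.
pose g' : 'cV[R]_n :=
  \col_i (h * (A *m y) i 0 - h * eps * (hessian_y A y *m x) i 0).
have -> : cmwu1 A h eps x y = exp_weights x g'.
  have wE l : cmwu_weight1 A h eps x y l = x l 0 * expR (g' l 0) by rewrite mxE.
  by apply/colP => i; rewrite mxE [RHS]mxE wE; under eq_bigr do rewrite wE.
(* [t + v] is the payoff at [(x, y)], the total mass of [D_y A^T x]; the constant part of [A] sees
   only this mass. *)
pose t := \sum_j y j 0 * (B^T *m x) j 0.
apply: (@exp_weights_shift _ _ _ _ (h * v - h * eps * (v * (t + v)))) => i.
rewrite exponentE mxE AE sy.2 /hessian_y -!mulmxA AE.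
have -> : \sum_j (diag_mx y^T *m (A^T *m x)) j 0 = t + v.
  rewrite -[v in RHS](simplex_sumC v sy) -big_split; apply: eq_bigr => j _ /=.
  by rewrite diag_mulmx ATE mulrDr.
have -> : diag_mx y^T *m (A^T *m x) = diag_mx y^T *m (B^T *m x) + v *: y.
  apply/colP => j; rewrite diag_mulmx ATE [RHS]mxE diag_mulmx [(v *: y) j 0]mxE; ring.
rewrite mulmxDr -scalemxAr.
have DE (u w : 'cV[R]_n) : (u + v *: w) i 0 = u i 0 + v * w i 0 by rewrite !mxE.
rewrite DE; ring.
Qed.

(** Player 2 is player 1 of the game [- A^T]: the Hessian is quadratic in the matrix, so only the
    first-order term changes sign. *)
Lemma cmwu2_swap A (h eps : R) x y :
  cmwu2 A h eps x y = cmwu1 (- A^T) h eps y x.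
Proof.
have wE j : cmwu_weight2 A h eps x y j = cmwu_weight1 (- A^T) h eps y x j.
  rewrite /cmwu_weight2 /cmwu_weight1 /hessian_x /hessian_y.
  have -> : (- A^T)^T = - A by apply/matrixP => i l; rewrite !mxE.
  have NE (u : 'cV[R]_m) : (- u) j 0 = - u j 0 by rewrite mxE.
  by rewrite !(mulNmx, mulmxN) !opprK NE mulrN mulNr.
by apply/colP => j; rewrite !mxE wE; under eq_bigr do rewrite wE.
Qed.

End PayoffShift.

(** Shifting [- A^T] by [- v] yields [- (A - v)^T], hence the factor [1 + eps * v]. *)
Lemma cmwu2E (R : realType) (n m : nat) (A : 'M[R]_(n, m)) (h eps v : R)
    (x : 'cV[R]_n) (y : 'cV[R]_m) : simplex R n x -> simplex R m y ->
  cmwu2 A h eps x y =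
  exp_weights y (exponent (- (A - const_mx v)^T) h (1 + eps * v) eps y x).
Proof.
move=> sx sy; rewrite cmwu2_swap (cmwu1E _ _ _ (- v) sy sx) mulrN opprK.
have -> : - (A - const_mx v)^T = - A^T - const_mx (- v).
  by apply/matrixP => j i; rewrite !mxE opprB addrC opprK.
reflexivity.
Qed.

(** * Best responses and complementary slackness at an equilibrium *)

Section Equilibrium.
Variables (R : realType) (n m : nat) (A : 'M[R]_(n, m)).
Variables (xs : 'cV[R]_n) (ys : 'cV[R]_m).
Hypothesis ne : nash_equilibrium A xs ys.
Let v := game_value A.

Lemma payoff_row (x : 'cV[R]_n) (y : 'cV[R]_m) :
  payoff A x y = \sum_i x i 0 * (A *m y) i 0.
Proof. by rewrite /payoff -mulmxA mxE; apply: eq_bigr => i _; rewrite mxE. Qed.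

Lemma payoff_col (x : 'cV[R]_n) (y : 'cV[R]_m) :
  payoff A x y = \sum_j y j 0 * (A^T *m x) j 0.
Proof. by rewrite payoff_row sum_mulmx_tr. Qed.

Lemma simplex_delta k (i : 'I_k) : simplex R k (delta_mx i 0).
Proof.
split=> [l|]; first by rewrite mxE; case: (_ && _).
rewrite (bigD1 i) //= mxE !eqxx /= big1 ?addr0 // => l li.
by rewrite mxE (negbTE li).
Qed.

Lemma sum_delta k (i : 'I_k) (f : 'I_k -> R) :
  \sum_l (delta_mx i 0 : 'cV[R]_k) l 0 * f l = f i.
Proof.
rewrite (bigD1 i) //= mxE !eqxx /= mul1r big1 ?addr0 // => l li.
by rewrite mxE (negbTE li) mul0r.
Qed.

Lemma nash_row_le i : (A *m ys) i 0 <= v.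
Proof.
rewrite /v (game_valueE ne); case: ne => _ _ /(_ _ (simplex_delta i)).
by rewrite payoff_row sum_delta.
Qed.

Lemma nash_col_ge j : v <= (A^T *m xs) j 0.
Proof.
rewrite /v (game_valueE ne); case: ne => _ _ _ /(_ _ (simplex_delta j)).
by rewrite lerN2 (payoff_col xs (delta_mx j 0)) sum_delta.
Qed.

(** Nonnegative terms whose sum is [v] minus the equilibrium payoff, which is 0. *)
Lemma nash_row_slack i : xs i 0 * (v - (A *m ys) i 0) = 0.
Proof.
have [sx _ _ _] := ne.
have /psumr_eq0P : \sum_i xs i 0 * (v - (A *m ys) i 0) = 0.
  under eq_bigr do rewrite mulrBr.
  by rewrite sumrB simplex_sumC // -payoff_row /v (game_valueE ne) subrr.
by apply=> // l _; rewrite mulr_ge0 ?sx.1 // subr_ge0 nash_row_le.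
Qed.

Lemma nash_col_slack j : ys j 0 * ((A^T *m xs) j 0 - v) = 0.
Proof.
have [_ sy _ _] := ne.
have /psumr_eq0P : \sum_j ys j 0 * ((A^T *m xs) j 0 - v) = 0.
  under eq_bigr do rewrite mulrBr.
  by rewrite sumrB simplex_sumC // -payoff_col /v (game_valueE ne) subrr.
by apply=> // l _; rewrite mulr_ge0 ?sy.1 // subr_ge0 nash_col_ge.
Qed.

End Equilibrium.

(** * Weak invertibility as a quantitative bound *)

Section Invertibility.
Variables (R : realType) (p q : nat) (M : 'M[R]_(p, q)).
Variables (S : {set 'I_p}) (T : {set 'I_q}).

Let Msub : 'M[R]_(#|S|, #|T|) :=
  mxsub (@enum_val _ (mem S)) (@enum_val _ (mem T)) M.

Lemma weakly_invertible_ker (z : 'cV[R]_q) :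
  weakly_invertible (zero_sum_space R #|T|) Msub ->
  (forall i, i \in S -> (M *m z) i 0 = 0) -> \sum_j z j 0 = 0 ->
  (forall j, j \notin T -> z j 0 = 0) -> z = 0.
Proof.
move=> /weakly_invertibleP wM Mz z0 zT.
pose z' : 'cV[R]_#|T| := \col_l z (enum_val l) 0.
have sumT (f : 'I_q -> R) : (forall j, j \notin T -> f j = 0) ->
    \sum_j f j = \sum_(l < #|T|) f (enum_val l).
  move=> fT; rewrite (bigID (mem T)) /= addrC big1 ?add0r; first exact: big_enum_val.
  by move=> j jT; exact: fT.
have z'0 : z' = 0.
  apply: wM.
    apply/mem_zero_sum_space; rewrite -[RHS]z0 sumT //.
    by apply: eq_bigr => l _; rewrite mxE.
  apply/colP => k; rewrite !mxE -[RHS](Mz (enum_val k) (enum_valP k)) mxE sumT.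
    by apply: eq_bigr => l _; rewrite !mxE.
  by move=> j jT; rewrite zT // mulr0.
apply/colP => j; rewrite mxE; have [jT|/zT//] := boolP (j \in T).
move/colP: z'0 => /(_ (enum_rank_in jT j)); rewrite !mxE.
by rewrite enum_rankK_in.
Qed.

(** The three constraints are stacked into one matrix [P], injective by the previous lemma; a left
    inverse [N] recovers [z] from its small image, with [L] the norm of [N]. *)
Lemma weakly_invertible_bound :
  weakly_invertible (zero_sum_space R #|T|) Msub ->
  exists2 L : R, 0 <= L & forall (z : 'cV[R]_q) (c : R), 0 <= c ->
    (forall i, i \in S -> `|(M *m z) i 0| <= c) -> \sum_j z j 0 = 0 ->
    (forall j, j \notin T -> `|z j 0| <= c) -> forall j, `|z j 0| <= L * c.
Proof.
move=> wM.
pose dS : 'cV[R]_p := \col_i (i \in S)%:R.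
pose dT : 'cV[R]_q := \col_j (j \notin T)%:R.
have dSE i : dS i 0 = (i \in S)%:R by rewrite mxE.
have dTE j : dT j 0 = (j \notin T)%:R by rewrite mxE.
pose P := col_mx (diag_mx dS^T *m M)
  (col_mx (const_mx 1 : 'rV[R]_q) (diag_mx dT^T)).
have PE (z : 'cV[R]_q) : P *m z = col_mx (diag_mx dS^T *m (M *m z))
    (col_mx (\col_(i < 1) \sum_j z j 0) (diag_mx dT^T *m z)).
  rewrite !mul_col_mx mulmxA; congr (col_mx _ (col_mx _ _)).
  apply/colP => i; rewrite !mxE; apply: eq_bigr => j _.
  by rewrite mxE mul1r.
have kerP (z : 'cV[R]_q) : P *m z = 0 -> z = 0.
  rewrite PE => /eqP; rewrite !col_mx_eq0 => /and3P[/eqP/colP d1 /eqP/colP d2 /eqP/colP d3].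
  apply: weakly_invertible_ker => // [i iS||j jT].
  - by have := d1 i; rewrite diag_mulmx dSE iS mul1r [RHS]mxE.
  - by have := d2 0; rewrite !mxE.
  - by have := d3 j; rewrite diag_mulmx dTE jT mul1r [RHS]mxE.
(* The columns of the cokernel matrix lie in the kernel of [P], so they vanish and [P] has a left
   inverse. *)
have /row_fullP[N NP] : row_full P.
  rewrite -cokermx_eq0; apply/eqP/matrixP => i j; rewrite [RHS]mxE.
  have /kerP/colP/(_ i) : P *m col j (cokermx P) = 0.
    by rewrite colE mulmxA mulmx_coker mul0mx.
  by rewrite !mxE.
exists (mx_l1 N) => [|z c c0 Mz z0 zT j]; first exact: mx_l1_ge0.
rewrite -[z]mul1mx -NP -mulmxA; apply: norm_mulmx_le => l; rewrite PE.
case: (split_ordP l) => [i|l'] ->.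
  rewrite col_mxEu diag_mulmx dSE.
  have [/Mz|] := boolP (i \in S); first by rewrite mul1r.
  by rewrite mul0r normr0.
rewrite col_mxEd; case: (split_ordP l') => [i|i] ->.
  by rewrite col_mxEu mxE z0 normr0.
rewrite col_mxEd diag_mulmx dTE.
have [|/zT] := boolP (i \in T); last by rewrite mul1r.
by rewrite mul0r normr0.
Qed.

End Invertibility.

(** * Lyapunov function *)

(* With weights be and al the cross terms of the two players cancel. *)
Lemma weighted_drift (R : realType)
    (h eps al be k1 k1' k2 k2' cross rho sigma Sa Sb : R) :
  0 <= h -> 0 <= al -> 0 <= be -> 0 <= Sa -> 0 <= Sb ->
  32 * h * (al * be) <= eps ->
  k1' - k1 <= h * al * cross - 3 / 4 * h * al * rho + 1 / 2 * h * al * sigma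
    - 3 / 4 * h * eps * Sa + 8 * (h * al) ^+ 2 * Sb ->
  k2' - k2 <= h * be * - cross - 3 / 4 * h * be * sigma + 1 / 2 * h * be * rho
    - 3 / 4 * h * eps * Sb + 8 * (h * be) ^+ 2 * Sa ->
  be * k1' + al * k2' <= be * k1 + al * k2 -
    (h / 4 * (al * be * (rho + sigma)) + h * eps / 2 * (be * Sa + al * Sb)).
Proof.
move=> h0 al0 be0 Sa0 Sb0 heps /(ler_wpM2l be0) P1 /(ler_wpM2l al0) P2.
(* The leftover [8 (h al)^2 be Sb] is at most [h eps al Sb / 4], and symmetrically for [Sa]: the
   friction keeps [3/4 - 1/4], the slack [3/4 - 1/2]. *)
have := ler_wpM2r (mulr_ge0 h0 (addr_ge0 (mulr_ge0 be0 Sa0) (mulr_ge0 al0 Sb0))) heps.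
lra.
Qed.

Section OneStep.
Variables (R : realType) (n m : nat) (A : 'M[R]_(n, m)).
Variables (xs : 'cV[R]_n) (ys : 'cV[R]_m).
Hypothesis ne : nash_equilibrium A xs ys.
Variables h eps al be : R.

Local Notation v := (game_value A).
Let B := A - const_mx v.
Let K := mx_l1 B.
Hypotheses (alE : al = 1 - eps * game_value A) (beE : be = 1 + eps * game_value A).
Hypotheses (h0 : 0 < h) (eps0 : 0 < eps) (epsv : eps * `|v| < 1).
Hypotheses (hK : 64 * h * K <= 1) (heK : 32 * h * eps * K ^+ 2 <= 1).
Hypothesis hleps : 32 * h <= eps.

Definition lyapunov (x : 'cV[R]_n) (y : 'cV[R]_m) : R :=
  be * kl xs x + al * kl ys y.

Definition slack (x : 'cV[R]_n) (y : 'cV[R]_m) : R :=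
  \sum_i x i 0 * (v - (A *m ys) i 0) + \sum_j y j 0 * ((A^T *m xs) j 0 - v).

Definition dissipation (x : 'cV[R]_n) (y : 'cV[R]_m) : R :=
  h / 4 * (al * be * slack x y)
  + h * eps / 2 * (be * (\sum_j y j 0 * (A^T *m (x - xs)) j 0 ^+ 2)
                 + al * (\sum_i x i 0 * (A *m (y - ys)) i 0 ^+ 2)).

(** The condition [eps < |1 / v|] enters here: [al + be = 2] and [al * be = 1 - (eps v)^2] with
    [|eps v| < 1]. *)
Lemma al_be_bounds : [/\ 0 < al, 0 < be, al <= 2, be <= 2 & al * be <= 1].
Proof.
have : `|eps * v| < 1 by rewrite normrM gtr0_norm.
rewrite ltr_norml => /andP[ev1 ev2].
have := sqr_ge0 (eps * v).
by rewrite alE beE; split; lra.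
Qed.

(** Both players' drift bounds are combined with weights [be] and [al]; closeness [rad] makes the
    deviations and slacks small enough for those bounds. *)
Lemma lyapunov_step (rad : R) x y :
  simplex R n x -> simplex R m y ->
  (forall i, xs i 0 != 0 -> 0 < x i 0) -> (forall j, ys j 0 != 0 -> 0 < y j 0) ->
  (forall i, `|x i 0 - xs i 0| <= rad) -> (forall j, `|y j 0 - ys j 0| <= rad) ->
  4 * eps * (K * rad) <= al -> 4 * eps * (K * rad) <= be ->
  32 * h * eps ^+ 2 * K ^+ 2 * (K * rad) <= al ->
  32 * h * eps ^+ 2 * K ^+ 2 * (K * rad) <= be ->
  lyapunov (cmwu1 A h eps x y) (cmwu2 A h eps x y)
    <= lyapunov x y - dissipation x y.
Proof.
move=> sx sy xpos ypos xrad yrad cal cbe cal2 cbe2.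
have [sxs sys _ _] := ne.
have [al0 be0 al2 be2 albe] := al_be_bounds.
have K0 : 0 <= K by exact: mx_l1_ge0.
have K' : mx_l1 (- B^T) = K by rewrite mx_l1N mx_l1_tr.
have NE k (u : 'cV[R]_k) i : (- u) i 0 = - u i 0 by rewrite mxE.
(* Differences of simplex points have coordinate sum 0, so the shift by [v] is invisible on them. *)
have aE : B^T *m (x - xs) = A^T *m (x - xs).
  by apply/colP => j; rewrite trmx_subC mulmx_subC sum_simplexB // mulr0 subr0.
have bE : B *m (y - ys) = A *m (y - ys).
  by apply/colP => i; rewrite mulmx_subC sum_simplexB // mulr0 subr0.
have rE i : (- (B *m ys)) i 0 = v - (A *m ys) i 0.
  by rewrite NE mulmx_subC sys.2 mulr1 opprB.
have sE j : (B^T *m xs) j 0 = (A^T *m xs) j 0 - v.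
  by rewrite trmx_subC mulmx_subC sxs.2 mulr1.
have BTTN : (- B^T)^T = - B by apply/matrixP => i l; rewrite !mxE.
have r'E j : (- (- B^T *m xs)) j 0 = (A^T *m xs) j 0 - v.
  by rewrite mulNmx opprK sE.
have s'E i : ((- B^T)^T *m ys) i 0 = v - (A *m ys) i 0.
  by rewrite BTTN mulNmx rE.
have a'E : (- B^T)^T *m (y - ys) = - (A *m (y - ys)).
  by rewrite BTTN mulNmx bE.
have b'E : - B^T *m (x - xs) = - (A^T *m (x - xs)) by rewrite mulNmx aE.
have r0 i : 0 <= v - (A *m ys) i 0 by rewrite subr_ge0 (nash_row_le ne).
have s0 j : 0 <= (A^T *m xs) j 0 - v by rewrite subr_ge0 (nash_col_ge ne).
have aK j : `|(A^T *m (x - xs)) j 0| <= K * rad.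
  rewrite -aE -[K]mx_l1_tr; apply: norm_mulmx_le => i.
  by rewrite !mxE; exact: xrad.
have bK i : `|(A *m (y - ys)) i 0| <= K * rad.
  by rewrite -bE; apply: norm_mulmx_le => j; rewrite !mxE; exact: yrad.
set rho := \sum_i x i 0 * (v - (A *m ys) i 0).
set sigma := \sum_j y j 0 * ((A^T *m xs) j 0 - v).
(* By complementary slackness [y] may be replaced by [y - ys], which makes [sigma] an average of
   payoff deviations. *)
have sigmaK : sigma <= K * rad.
  have -> : sigma = \sum_i xs i 0 * (A *m (y - ys)) i 0.
    rewrite -bE sum_mulmx_tr; apply: eq_bigr => j _; rewrite sE.
    by rewrite [(y - ys) j 0]mxE NE mulrBl (nash_col_slack ne) subr0.
  rewrite -[leRHS](simplex_sumC _ sxs); apply: ler_sum => i _.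
  by rewrite ler_wpM2l ?sxs.1 //; exact: le_trans (ler_norm _) (bK i).
have rhoK : rho <= K * rad.
  have -> : rho = \sum_j ys j 0 * (- (A^T *m (x - xs)) j 0).
    under eq_bigr do rewrite -NE -mulNmx.
    have -> : - A^T *m (x - xs) = (- B)^T *m (x - xs).
      by rewrite mulNmx -aE -mulNmx; congr (_ *m _); apply/matrixP => i l; rewrite !mxE.
    rewrite -sum_mulmx_tr; apply: eq_bigr => i _; rewrite mulNmx rE.
    by rewrite [(x - xs) i 0]mxE NE mulrBl (nash_row_slack ne) subr0.
  rewrite -[leRHS](simplex_sumC _ sys); apply: ler_sum => j _.
  by rewrite ler_wpM2l ?sys.1 //; apply: le_trans (ler_norm _) _; rewrite normrN.
have step2 : 32 * h * (al * be) <= eps.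
  by apply: le_trans hleps; have := ler_wpM2l (ltW h0) albe; lra.
(* Exchanging the players swaps [a] with [- b] and [r] with [s], so the two cross terms are
   opposite. *)
have P1 := @drift_le R n m B h al eps x xs y ys sx sy sys.
have P2 := @drift_le R m n (- B^T) h be eps y ys x xs sy sx sxs.
rewrite K' aE bE a'E b'E -/K in P1 P2.
set Sa := \sum_j y j 0 * (A^T *m (x - xs)) j 0 ^+ 2 in P1.
set Sb := \sum_i x i 0 * (A *m (y - ys)) i 0 ^+ 2 in P1.
set cross := \sum_i (x i 0 - xs i 0) * (A *m (y - ys)) i 0 in P1.
have rhoE1 : \sum_i x i 0 * (- (B *m ys)) i 0 = rho.
  by apply: eq_bigr => i _; rewrite rE.
have rhoE2 : \sum_i x i 0 * ((- B^T)^T *m ys) i 0 = rho.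
  by apply: eq_bigr => i _; rewrite s'E.
have sigmaE1 : \sum_j y j 0 * (B^T *m xs) j 0 = sigma.
  by apply: eq_bigr => j _; rewrite sE.
have sigmaE2 : \sum_j y j 0 * (- (- B^T *m xs)) j 0 = sigma.
  by apply: eq_bigr => j _; rewrite r'E.
have SaE : \sum_j y j 0 * (- (A^T *m (x - xs))) j 0 ^+ 2 = Sa.
  by apply: eq_bigr => j _; rewrite NE sqrrN.
have SbE : \sum_i x i 0 * (- (A *m (y - ys))) i 0 ^+ 2 = Sb.
  by apply: eq_bigr => i _; rewrite NE sqrrN.
have crossE : \sum_j (y j 0 - ys j 0) * (- (A^T *m (x - xs))) j 0 = - cross.
  have -> : cross = \sum_i (x - xs) i 0 * (A *m (y - ys)) i 0.
    by apply: eq_bigr => i _; rewrite !mxE.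
  by rewrite sum_mulmx_tr -sumrN; apply: eq_bigr => j _; rewrite NE !mxE mulrN.
rewrite rhoE1 sigmaE1 in P1; rewrite rhoE2 sigmaE2 SaE SbE crossE in P2.
have h0' := ltW h0; have eps0' := ltW eps0.
have c1 : 32 * h * al * K <= 1.
  by apply: le_trans hK; have := ler_wpM2r (mulr_ge0 h0' K0) al2; lra.
have c2 : 32 * h * be * K <= 1.
  by apply: le_trans hK; have := ler_wpM2r (mulr_ge0 h0' K0) be2; lra.
have hK2 : 0 <= 32 * h * eps ^+ 2 * K ^+ 2 by rewrite !mulr_ge0 ?sqr_ge0.
have eps4 : 0 <= 4 * eps by rewrite mulr_ge0.
have {}P1 := P1 _ _ _ h0' (ltW al0) eps0' c1 heK _
  (le_trans (ler_wpM2l hK2 sigmaK) cal2).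
have {}P2 := P2 _ _ _ h0' (ltW be0) eps0' c2 heK _
  (le_trans (ler_wpM2l hK2 rhoK) cbe2).
have g1 := kl_exp_weights sxs sx xpos
  (fun i => exponent_le i sx sy h0' (ltW al0) eps0' c1 heK).
have g2 := @kl_exp_weights _ _ ys y (exponent (- B^T) h be eps y x) sys sy ypos.
rewrite (cmwu1E _ _ _ v sx sy) (cmwu2E _ _ _ v sx sy) -/B -alE -beE.
rewrite /lyapunov /dissipation /slack; apply: weighted_drift step2 _ _.
- exact: h0'.
- exact: ltW al0.
- exact: ltW be0.
- by apply: sumr_ge0 => j _; rewrite mulr_ge0 ?sqr_ge0 ?sy.1.
- by apply: sumr_ge0 => i _; rewrite mulr_ge0 ?sqr_ge0 ?sx.1.
- apply: le_trans g1 (P1 _ _ _ _) => [i|j|i|j].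
  + by rewrite rE.
  + by rewrite sE.
  + by rewrite rE (nash_row_slack ne).
  + exact: le_trans (ler_wpM2l eps4 (aK j)) cal.
- apply: le_trans (g2 _) (P2 _ _ _ _) => [j|j|i|j|i].
  + by apply: exponent_le; rewrite ?K' ?(ltW be0).
  + by rewrite r'E.
  + by rewrite s'E.
  + by rewrite r'E (nash_col_slack ne).
  + by rewrite NE normrN; exact: le_trans (ler_wpM2l eps4 (bK i)) cbe.
Qed.

End OneStep.

(** * Convergence *)

Lemma finite_pos_lbound (R : realType) (T : finType) (P : pred T) (f : T -> R) :
  (forall i, P i -> 0 < f i) ->
  exists2 k : R, 0 < k & forall i, P i -> k <= f i.
Proof.
move=> f0; exists (\big[Order.min/1]_(i | P i) f i).
  by apply: lt_bigmin => //; exact: ltr01.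
by move=> i Pi; exact: bigmin_le_cond.
Qed.

Lemma ler_sum_ge0 (R : realType) (T : finType) (f : T -> R) (i : T) :
  (forall j, 0 <= f j) -> f i <= \sum_j f j.
Proof. by move=> f0; rewrite (bigD1 i) //= lerDl sumr_ge0. Qed.

Lemma cvg_colvec (R : realType) (k : nat) (u : nat -> 'cV[R]_k) (l : 'cV[R]_k) :
  (forall e, 0 < e -> \forall t \near \oo, forall i, `|u t i 0 - l i 0| < e) ->
  u @ \oo --> l.
Proof.
move=> H; apply/cvg_ballP => e e0; near=> t.
split=> // i j; rewrite ord1 -ball_normE /= distrC.
by move: i; near: t; exact: H.
Unshelve. all: by end_near. Qed.

Lemma cvg_coord (R : realType) (k : nat) (p : 'cV[R]_k) (T : Type)
    (F : set_system T) (FF : Filter F) (f : T -> 'cV[R]_k) i :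
  f @ F --> p -> f t i 0 @[t --> F] --> p i 0.
Proof.
move=> fp.
exact: (@cvg_comp _ _ _ f (fun M => M i 0) _ _ _ fp (@coord_continuous R k 1 i 0 p)).
Qed.

(** Terms with [p i 0 = 0] vanish identically, so [ln] is only needed at positive points, where it
    is continuous. *)
Lemma cvg_kl (R : realType) (k : nat) (p : 'cV[R]_k) (T : Type)
    (F : set_system T) (FF : Filter F) (f : T -> 'cV[R]_k) :
  simplex R k p -> f @ F --> p -> kl p (f t) @[t --> F] --> 0.
Proof.
move=> sp fp; rewrite -[X in _ --> X](kl_refl p) /kl.
apply: cvg_big => [|i _]; first exact: add_continuous.
have [->|pi0] := eqVneq (p i 0) 0.
  by under eq_fun do rewrite mul0r; rewrite mul0r; exact: cvg_cst.
apply: cvgM; first exact: cvg_cst.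
apply: cvgB; first exact: cvg_cst.
have fpi : f t i 0 @[t --> F] --> p i 0 by exact: cvg_coord.
apply: (@cvg_comp _ _ _ (fun t => f t i 0) (@ln R) _ _ _ fpi).
by apply: continuous_ln; rewrite lt0r pi0 sp.1.
Qed.

Lemma near_pos (R : realType) (k : nat) (p : 'cV[R]_k) (T : Type)
    (F : set_system T) (FF : Filter F) (f : T -> 'cV[R]_k) :
  simplex R k p -> f @ F --> p ->
  \forall t \near F, forall i, p i 0 != 0 -> 0 < f t i 0.
Proof.
move=> sp fp; apply: (@filter_forall _ 'I_k) => i.
have [pi0|pi0] := eqVneq (p i 0) 0; first by near=> t.
have fpi : f t i 0 @[t --> F] --> p i 0 by exact: cvg_coord.
have pi_gt0 : 0 < p i 0 by rewrite lt0r pi0 sp.1.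
by near=> t => _; near: t; exact: cvgr_gt fpi _ pi_gt0.
Unshelve. all: by end_near. Qed.

Section Convergence.
Variables (R : realType) (n m : nat) (A : 'M[R]_(n, m)).
Variables (xs : 'cV[R]_n) (ys : 'cV[R]_m).
Hypothesis qs : quasi_strict A xs ys.
Hypothesis HA :
  weakly_invertible (zero_sum_space R #|supp ys|) (supp_submx A xs ys).
Hypothesis HAT :
  weakly_invertible (zero_sum_space R #|supp xs|) (supp_submx A xs ys)^T.
Variables h eps al be : R.

Local Notation v := (game_value A).
Let K := mx_l1 (A - const_mx v).

Hypotheses (alE : al = 1 - eps * v) (beE : be = 1 + eps * v).
Hypotheses (h0 : 0 < h) (eps0 : 0 < eps) (epsv : eps * `|v| < 1).
Hypotheses (hK : 64 * h * K <= 1) (heK : 32 * h * eps * K ^+ 2 <= 1).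
Hypothesis hleps : 32 * h <= eps.

Let ne : nash_equilibrium A xs ys. Proof. by case: qs. Qed.
Let sxs : simplex R n xs. Proof. by case: ne. Qed.
Let sys : simplex R m ys. Proof. by case: ne. Qed.
Let al0 : 0 < al. Proof. by have [] := al_be_bounds alE beE eps0 epsv. Qed.
Let be0 : 0 < be. Proof. by have [] := al_be_bounds alE beE eps0 epsv. Qed.

Let row0 i : 0 <= v - (A *m ys) i 0.
Proof. by rewrite subr_ge0 (nash_row_le ne). Qed.

Let col0 j : 0 <= (A^T *m xs) j 0 - v.
Proof. by rewrite subr_ge0 (nash_col_ge ne). Qed.

(** Invertibility of the transposed submatrix controls [x], that of the submatrix itself controls
    [y]. *)
Lemma distance_bound : exists2 L : R, 0 <= L &
  forall (x : 'cV[R]_n) (y : 'cV[R]_m) (c : R),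
    simplex R n x -> simplex R m y -> 0 <= c ->
    (forall i, xs i 0 = 0 -> x i 0 <= c) ->
    (forall j, ys j 0 = 0 -> y j 0 <= c) ->
    (forall j, ys j 0 != 0 -> `|(A^T *m (x - xs)) j 0| <= c) ->
    (forall i, xs i 0 != 0 -> `|(A *m (y - ys)) i 0| <= c) ->
    (forall i, `|x i 0 - xs i 0| <= L * c) /\
    (forall j, `|y j 0 - ys j 0| <= L * c).
Proof.
have [Ly Ly0 Hy] := weakly_invertible_bound HA.
have HAT' : weakly_invertible (zero_sum_space R #|supp xs|)
    (mxsub (@enum_val _ (mem (supp ys))) (@enum_val _ (mem (supp xs))) A^T).
  by move: HAT; rewrite /supp_submx trmx_mxsub.
have [Lx Lx0 Hx] := weakly_invertible_bound HAT'.
have subE k (u w : 'cV[R]_k) i : (u - w) i 0 = u i 0 - w i 0 by rewrite !mxE.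
exists (Lx + Ly) => [|x y c sx sy c0 xc yc ac bc]; first exact: addr_ge0.
split=> [i|j].
- have := Hx (x - xs) c c0 _ (sum_simplexB sx sxs) _ i; rewrite subE => Hxi.
  apply: le_trans (Hxi _ _) _ => [j|l|].
  + by rewrite inE => /ac.
  + rewrite inE negbK => /eqP l0; rewrite subE l0 subr0 ger0_norm ?xc //.
    exact: sx.1.
  + by rewrite ler_wpM2r // lerDl.
- have := Hy (y - ys) c c0 _ (sum_simplexB sy sys) _ j; rewrite subE => Hyj.
  apply: le_trans (Hyj _ _) _ => [i|l|].
  + by rewrite inE => /bc.
  + rewrite inE negbK => /eqP l0; rewrite subE l0 subr0 ger0_norm ?yc //.
    exact: sy.1.
  + by rewrite ler_wpM2r // lerDr.
Qed.

Let sqr_sum_ge0 k (d w : 'cV[R]_k) :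
  simplex R k d -> 0 <= \sum_i d i 0 * w i 0 ^+ 2.
Proof. by move=> sd; apply: sumr_ge0 => i _; rewrite mulr_ge0 ?sqr_ge0 ?sd.1. Qed.

Lemma dissipation_ge0 x y :
  simplex R n x -> simplex R m y -> 0 <= dissipation A xs ys h eps al be x y.
Proof.
move=> sx sy; have al0' := ltW al0; have be0' := ltW be0.
have h0' := ltW h0; have eps0' := ltW eps0.
have s0 : 0 <= slack A xs ys x y.
  by apply: addr_ge0; apply: sumr_ge0 => i _; rewrite mulr_ge0 ?sx.1 ?sy.1.
rewrite /dissipation addr_ge0 ?mulr_ge0 ?invr_ge0 ?ler0n //.
by rewrite addr_ge0 ?mulr_ge0 ?sqr_sum_ge0.
Qed.

(** Dissipation is linear in the mass outside the supports, with rates bounded below by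
    quasi-strictness, but quadratic in the deviations on the supports; hence one hypothesis in [e]
    and one in [e ^+ 2]. *)
Lemma dissipation_control : exists L k : R, [/\ 0 < L, 0 < k &
  forall (x : 'cV[R]_n) (y : 'cV[R]_m) (e : R),
    simplex R n x -> simplex R m y -> 0 < e ->
    (forall i, xs i 0 / 2 <= x i 0) ->
    (forall j, ys j 0 / 2 <= y j 0) ->
    dissipation A xs ys h eps al be x y <= k * e ->
    dissipation A xs ys h eps al be x y <= k * e ^+ 2 ->
    (forall i, `|x i 0 - xs i 0| <= L * e) /\
    (forall j, `|y j 0 - ys j 0| <= L * e)].
Proof.
have [_ qrow qcol] := qs.
have [L L0 HL] := distance_bound.
have [kr kr0 Hr] : exists2 k : R, 0 < k &
    forall i, xs i 0 == 0 -> k <= v - (A *m ys) i 0.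
  by apply: finite_pos_lbound => i /eqP /qrow; rewrite subr_gt0.
have [kc kc0 Hc] : exists2 k : R, 0 < k &
    forall j, ys j 0 == 0 -> k <= (A^T *m xs) j 0 - v.
  by apply: finite_pos_lbound => j /eqP /qcol; rewrite subr_gt0.
have [kx kx0 Hx] : exists2 k : R, 0 < k & forall i, xs i 0 != 0 -> k <= xs i 0 / 2.
  by apply: finite_pos_lbound => i i0; rewrite divr_gt0 // lt0r i0 sxs.1.
have [ky ky0 Hy] : exists2 k : R, 0 < k & forall j, ys j 0 != 0 -> k <= ys j 0 / 2.
  by apply: finite_pos_lbound => j j0; rewrite divr_gt0 // lt0r j0 sys.1.
have h40 : 0 < h / 4 by rewrite divr_gt0.
have he20 : 0 < h * eps / 2 by rewrite divr_gt0 // mulr_gt0.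
have albe0 : 0 < al * be by rewrite mulr_gt0.
(* Least coefficients with which a single off-support mass or a single squared deviation enters the
   dissipation. *)
pose k1 := h / 4 * (al * be * kr); pose k2 := h / 4 * (al * be * kc).
pose k3 := h * eps / 2 * (be * ky); pose k4 := h * eps / 2 * (al * kx).
have k10 : 0 < k1 by rewrite !mulr_gt0.
have k20 : 0 < k2 by rewrite !mulr_gt0.
have k30 : 0 < k3 by rewrite mulr_gt0 // mulr_gt0.
have k40 : 0 < k4 by rewrite mulr_gt0 // mulr_gt0.
pose k := Num.min (Num.min k1 k2) (Num.min k3 k4).
have k0 : 0 < k by rewrite !lt_min k10 k20 k30 k40.
have kk1 : k <= k1 by rewrite !ge_min lexx.
have kk2 : k <= k2 by rewrite !ge_min lexx orbT.
have kk3 : k <= k3 by rewrite !ge_min lexx !orbT.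
have kk4 : k <= k4 by rewrite !ge_min lexx !orbT.
(* The added 1 makes the constant positive, since it later serves as a divisor. *)
exists (L + 1), k; split=> [||x y e sx sy e0 xlow ylow De De2] //.
  by rewrite (le_lt_trans L0) ?ltrDl.
set a := A^T *m (x - xs); set b := A *m (y - ys).
set rho := \sum_i x i 0 * (v - (A *m ys) i 0).
set sigma := \sum_j y j 0 * ((A^T *m xs) j 0 - v).
set Sa := \sum_j y j 0 * a j 0 ^+ 2; set Sb := \sum_i x i 0 * b i 0 ^+ 2.
have rho0 : 0 <= rho by apply: sumr_ge0 => i _; rewrite mulr_ge0 ?sx.1.
have sigma0 : 0 <= sigma by apply: sumr_ge0 => j _; rewrite mulr_ge0 ?sy.1.
have Sa0 : 0 <= Sa by exact: sqr_sum_ge0.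
have Sb0 : 0 <= Sb by exact: sqr_sum_ge0.
set D := dissipation _ _ _ _ _ _ _ _ _ in De De2.
have DE : D = h / 4 * (al * be * (rho + sigma))
  + h * eps / 2 * (be * Sa + al * Sb) by [].
have t1 : 0 <= h / 4 * (al * be * rho).
  by rewrite (mulr_ge0 (ltW h40)) // (mulr_ge0 (ltW albe0)).
have t2 : 0 <= h / 4 * (al * be * sigma).
  by rewrite (mulr_ge0 (ltW h40)) // (mulr_ge0 (ltW albe0)).
have t3 : 0 <= h * eps / 2 * (be * Sa) by rewrite (mulr_ge0 (ltW he20)) // (mulr_ge0 (ltW be0)).
have t4 : 0 <= h * eps / 2 * (al * Sb) by rewrite (mulr_ge0 (ltW he20)) // (mulr_ge0 (ltW al0)).
have D1 : h / 4 * (al * be * rho) <= D by rewrite DE; lra.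
have D2 : h / 4 * (al * be * sigma) <= D by rewrite DE; lra.
have D3 : h * eps / 2 * (be * Sa) <= D by rewrite DE; lra.
have D4 : h * eps / 2 * (al * Sb) <= D by rewrite DE; lra.
have cancel_lin (z w : R) : 0 <= z -> k * z <= D -> D <= k * w -> z <= w.
  by move=> z0 /le_trans H /H; rewrite ler_pM2l.
have sqr_le (z : R) : k * z ^+ 2 <= D -> `|z| <= e.
  move=> kz; rewrite -(ler_pXn2r (n := 2)) ?nnegrE ?(ltW e0) //.
  rewrite real_normK ?num_real //; exact: (cancel_lin _ _ (sqr_ge0 z) kz De2).
have e0' := ltW e0.
have q1 i : xs i 0 = 0 -> x i 0 <= e.
  move=> i0; apply: (cancel_lin _ _ (sx.1 i) _ De); apply: le_trans D1.
  apply: le_trans (ler_wpM2r (sx.1 i) kk1) _; rewrite /k1.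
  have -> : h / 4 * (al * be * kr) * x i 0 = h / 4 * (al * be * (x i 0 * kr)) by ring.
  rewrite (ler_wpM2l (ltW h40)) // (ler_wpM2l (ltW albe0)) //.
  apply: le_trans (ler_sum_ge0 i _) => [|l]; last by rewrite mulr_ge0 ?sx.1.
  by rewrite ler_wpM2l ?sx.1 // Hr // i0.
have q2 j : ys j 0 = 0 -> y j 0 <= e.
  move=> j0; apply: (cancel_lin _ _ (sy.1 j) _ De); apply: le_trans D2.
  apply: le_trans (ler_wpM2r (sy.1 j) kk2) _; rewrite /k2.
  have -> : h / 4 * (al * be * kc) * y j 0 = h / 4 * (al * be * (y j 0 * kc)) by ring.
  rewrite (ler_wpM2l (ltW h40)) // (ler_wpM2l (ltW albe0)) //.
  apply: le_trans (ler_sum_ge0 j _) => [|l]; last by rewrite mulr_ge0 ?sy.1.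
  by rewrite ler_wpM2l ?sy.1 // Hc // j0.
have q3 j : ys j 0 != 0 -> `|a j 0| <= e.
  move=> j0; apply: sqr_le; apply: le_trans D3.
  apply: le_trans (ler_wpM2r (sqr_ge0 _) kk3) _; rewrite /k3.
  have -> : h * eps / 2 * (be * ky) * a j 0 ^+ 2 =
    h * eps / 2 * (be * (ky * a j 0 ^+ 2)) by ring.
  rewrite (ler_wpM2l (ltW he20)) // (ler_wpM2l (ltW be0)) //.
  apply: le_trans (ler_sum_ge0 j _) => [|l]; last by rewrite mulr_ge0 ?sqr_ge0 ?sy.1.
  by rewrite ler_wpM2r ?sqr_ge0 //; exact: le_trans (Hy _ j0) (ylow j).
have q4 i : xs i 0 != 0 -> `|b i 0| <= e.
  move=> i0; apply: sqr_le; apply: le_trans D4.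
  apply: le_trans (ler_wpM2r (sqr_ge0 _) kk4) _; rewrite /k4.
  have -> : h * eps / 2 * (al * kx) * b i 0 ^+ 2 =
    h * eps / 2 * (al * (kx * b i 0 ^+ 2)) by ring.
  rewrite (ler_wpM2l (ltW he20)) // (ler_wpM2l (ltW al0)) //.
  apply: le_trans (ler_sum_ge0 i _) => [|l]; last by rewrite mulr_ge0 ?sqr_ge0 ?sx.1.
  by rewrite ler_wpM2r ?sqr_ge0 //; exact: le_trans (Hx _ i0) (xlow i).
have [Hdx Hdy] := HL x y e sx sy e0' q1 q2 q3 q4; split=> [i|j].
  by apply: le_trans (Hdx i) _; rewrite ler_wpM2r // lerDl.
by apply: le_trans (Hdy j) _; rewrite ler_wpM2r // lerDl.
Qed.

(** Each entropy is at most its share of [V], and squared distances are at most 4 times the entropy;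
    the 8 accounts for this 4 and for [al, be <= 2]. *)
Lemma lyapunov_small (rad : R) x y :
  simplex R n x -> simplex R m y ->
  (forall i, xs i 0 != 0 -> 0 < x i 0) -> (forall j, ys j 0 != 0 -> 0 < y j 0) ->
  0 <= rad -> lyapunov xs ys al be x y < al * be * rad ^+ 2 / 8 ->
  (forall i, `|x i 0 - xs i 0| <= rad) /\ (forall j, `|y j 0 - ys j 0| <= rad).
Proof.
move=> sx sy xpos ypos rad0; rewrite /lyapunov => V.
have [_ _ al2 be2 _] := al_be_bounds alE beE eps0 epsv.
have klx := kl_ge0 sxs sx xpos; have kly := kl_ge0 sys sy ypos.
have V1 : be * kl xs x <= be * (al * rad ^+ 2 / 8).
  by have := mulr_ge0 (ltW al0) kly; lra.
have V2 : al * kl ys y <= al * (be * rad ^+ 2 / 8).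
  by have := mulr_ge0 (ltW be0) klx; lra.
rewrite ler_pM2l // in V1; rewrite ler_pM2l // in V2.
have alr := ler_wpM2r (sqr_ge0 rad) al2.
have ber := ler_wpM2r (sqr_ge0 rad) be2.
split=> i; rewrite -(ler_pXn2r (n := 2)) ?nnegrE // real_normK ?num_real //.
  by apply: le_trans (kl_ge i sxs sx xpos) _; lra.
by apply: le_trans (kl_ge i sys sy ypos) _; lra.
Qed.

(** Since [al * be / 2] is below both [al] and [be], one radius meets all smallness conditions of
    [lyapunov_step], and it keeps support coordinates above half their equilibrium value. *)
Lemma radius_exists : exists rad : R, [/\ 0 < rad,
  4 * eps * (K * rad) <= al * be / 2,
  32 * h * eps ^+ 2 * K ^+ 2 * (K * rad) <= al * be / 2,
  (forall i, xs i 0 != 0 -> rad <= xs i 0 / 2) &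
  (forall j, ys j 0 != 0 -> rad <= ys j 0 / 2)].
Proof.
have K0 : 0 <= K by exact: mx_l1_ge0.
have [kx kx0 Hx] : exists2 k : R, 0 < k & forall i, xs i 0 != 0 -> k <= xs i 0 / 2.
  by apply: finite_pos_lbound => i i0; rewrite divr_gt0 // lt0r i0 sxs.1.
have [ky ky0 Hy] : exists2 k : R, 0 < k & forall j, ys j 0 != 0 -> k <= ys j 0 / 2.
  by apply: finite_pos_lbound => j j0; rewrite divr_gt0 // lt0r j0 sys.1.
pose q1 := 4 * eps * K; pose q2 := 32 * h * eps ^+ 2 * K ^+ 2 * K.
have q10 : 0 <= q1 by rewrite !mulr_ge0 // ltW.
have q20 : 0 <= q2 by rewrite !mulr_ge0 ?sqr_ge0 // ltW.
have Q0 : 0 < q1 + q2 + 1 by rewrite ltr_wpDl ?addr_ge0.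
pose c := al * be / 2.
have c0 : 0 < c by rewrite divr_gt0 // mulr_gt0.
(* The 1 in the denominator keeps it positive when [K = 0]. *)
pose rad := Num.min (c / (q1 + q2 + 1)) (Num.min kx ky).
have rad0 : 0 < rad by rewrite !lt_min kx0 ky0 divr_gt0.
have radQ : rad * (q1 + q2 + 1) <= c.
  by rewrite -ler_pdivlMr // ge_min lexx.
have radx : rad <= kx by rewrite !ge_min lexx !orbT.
have rady : rad <= ky by rewrite !ge_min lexx !orbT.
have r1 := mulr_ge0 (ltW rad0) q10; have r2 := mulr_ge0 (ltW rad0) q20.
exists rad; split=> //.
- by rewrite mulrA -/q1 -/c mulrC; lra.
- by rewrite mulrA -/q2 -/c mulrC; lra.
- by move=> i /Hx; exact: le_trans.
- by move=> j /Hy; exact: le_trans.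
Qed.

(** A sublevel set of [V] is invariant because [V] decreases; [V] then converges along the orbit,
    and its decrements dominate the dissipation. *)
Lemma cmwu_local_convergence :
  exists U : set ('cV[R]_n * 'cV[R]_m),
    [/\ U `<=` simplex R n `*` simplex R m,
        within (simplex R n `*` simplex R m) (nbhs (xs, ys)) U &
        forall (x : nat -> 'cV[R]_n) (y : nat -> 'cV[R]_m),
          U (x 0%N, y 0%N) ->
          (forall t, x t.+1 = cmwu1 A h eps (x t) (y t)) ->
          (forall t, y t.+1 = cmwu2 A h eps (x t) (y t)) ->
          (cmwu1 A h eps (x t) (y t), cmwu2 A h eps (x t) (y t))
            @[t --> \oo] --> (xs, ys)].
Proof.
have [_ _ al2 be2 _] := al_be_bounds alE beE eps0 epsv.
have [rad [rad0 rad1 rad2 radx rady]] := radius_exists.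
have calal : al * be / 2 <= al.
  by have := ler_wpM2l (ltW al0) be2; lra.
have calbe : al * be / 2 <= be.
  by have := ler_wpM2r (ltW be0) al2; lra.
pose c := al * be * rad ^+ 2 / 8.
have c0 : 0 < c by rewrite divr_gt0 // !mulr_gt0 // exprn_gt0.
pose V := lyapunov xs ys al be.
pose D := dissipation A xs ys h eps al be.
(* Positivity on the supports is part of [U] because only there is [V] a genuine entropy. *)
pose U : set ('cV[R]_n * 'cV[R]_m) := [set p | [/\ simplex R n p.1,
  simplex R m p.2, (forall i, xs i 0 != 0 -> 0 < p.1 i 0),
  (forall j, ys j 0 != 0 -> 0 < p.2 j 0) & V p.1 p.2 < c]].
have UV x y : U (x, y) ->
    V (cmwu1 A h eps x y) (cmwu2 A h eps x y) <= V x y - D x y.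
  move=> [/= sx sy xpos ypos Vc].
  have [xrad yrad] := lyapunov_small sx sy xpos ypos (ltW rad0) Vc.
  by apply: (lyapunov_step ne alE beE h0 eps0 epsv hK heK hleps
    sx sy xpos ypos xrad yrad); [exact: le_trans rad1 _|exact: le_trans rad1 _|
    exact: le_trans rad2 _|exact: le_trans rad2 _].
have Ustep x y : U (x, y) -> U (cmwu1 A h eps x y, cmwu2 A h eps x y).
  move=> Uxy; have := UV _ _ Uxy; have [/= sx sy xpos ypos Vc] := Uxy => VV.
  have [sx' sy'] := cmwu_simplex A h eps sx sy; split=> //=.
  (* The shift is irrelevant to positivity; the value 0 just exposes the multiplicative form. *)
  - by move=> i /xpos xi; rewrite (cmwu1E _ _ _ 0 sx sy) exp_weights_gt0.
  - by move=> j /ypos yj; rewrite (cmwu2E _ _ _ 0 sx sy) exp_weights_gt0.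
  - apply: le_lt_trans VV _; apply: le_lt_trans Vc.
    by rewrite lerBlDr lerDl dissipation_ge0.
exists U; split; first by move=> p [].
- have f1 : p.1 @[p --> (xs, ys)] --> xs by exact: cvg_fst.
  have f2 : p.2 @[p --> (xs, ys)] --> ys by exact: cvg_snd.
  have Vcvg : V p.1 p.2 @[p --> (xs, ys)] --> (0 : R).
    rewrite -[X in _ --> X](_ : be * 0 + al * 0 = 0); last by rewrite !mulr0 addr0.
    apply: cvgD; apply: cvgM; [exact: cvg_cst|exact: cvg_kl|exact: cvg_cst|exact: cvg_kl].
  rewrite /within /=; near=> p => -[sx sy]; split=> //.
  + by near: p; exact: near_pos.
  + by near: p; exact: near_pos.
  + by near: p; exact: cvgr_lt Vcvg _ c0.
move=> x y U0 xS yS.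
have Ut t : U (x t, y t).
  by elim: t => // t; rewrite xS yS; exact: Ustep.
pose u t := V (x t) (y t).
have u0 t : 0 <= u t.
  have [/= sx sy xpos ypos _] := Ut t.
  by rewrite addr_ge0 // mulr_ge0 ?kl_ge0 // ltW.
have uD t : D (x t) (y t) <= u t - u t.+1.
  by rewrite /u xS yS; have := UV _ _ (Ut t); lra.
have D0 t : 0 <= D (x t) (y t).
  by have [/= sx sy _ _ _] := Ut t; exact: dissipation_ge0.
have ucvg : cvgn u.
  apply: nonincreasing_is_cvgn.
    by apply/nonincreasing_seqP => t; have := uD t; have := D0 t; lra.
  by exists 0 => _ [t _ <-].
have ducvg : u t - u t.+1 @[t --> \oo] --> (0 : R).
  rewrite -(subrr (limn u)); apply: cvgB => //.
  by rewrite (cvg_shiftS u).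
have [L [k [L0 k0 HL]]] := dissipation_control.
have close e : 0 < e -> \forall t \near \oo,
    (forall i, `|x t i 0 - xs i 0| < e) /\ (forall j, `|y t j 0 - ys j 0| < e).
  move=> e0; pose e' := e / (2 * L).
  have e'0 : 0 < e' by rewrite divr_gt0 // mulr_gt0.
  have Le' : L * e' < e.
    have -> : L * e' = e / 2 by rewrite /e'; field; exact: lt0r_neq0.
    lra.
  have c1 : 0 < k * e' by rewrite mulr_gt0.
  have c2 : 0 < k * e' ^+ 2 by rewrite mulr_gt0 // exprn_gt0.
  near=> t.
  have [/= sx sy xpos ypos Vc] := Ut t.
  have [xrad yrad] := lyapunov_small sx sy xpos ypos (ltW rad0) Vc.
  (* On the support [z >= p - rad >= p / 2]; off it the claim is [0 <= z]. *)
  have low (p z : R) : (p != 0 -> rad <= p / 2) -> `|z - p| <= rad -> 0 <= z -> p / 2 <= z.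
    have [->|_ /(_ isT) rp] := eqVneq p 0; first by rewrite mul0r.
    by rewrite ler_norml => /andP[zp _] _; lra.
  have [||||] := HL (x t) (y t) e' sx sy e'0.
  - by move=> i; apply: low (xrad i) (sx.1 i); exact: radx.
  - by move=> j; apply: low (yrad j) (sy.1 j); exact: rady.
  - apply: le_trans (uD t) (ltW _); near: t; exact: cvgr_lt ducvg _ c1.
  - apply: le_trans (uD t) (ltW _); near: t; exact: cvgr_lt ducvg _ c2.
  by move=> Hx Hy; split=> i; apply: le_lt_trans Le'; [exact: Hx|exact: Hy].
have xcvg : x @ \oo --> xs.
  by apply: cvg_colvec => e e0; apply: filterS (close e e0) => t [].
have ycvg : y @ \oo --> ys.
  by apply: cvg_colvec => e e0; apply: filterS (close e e0) => t [].
have xcvg1 : cmwu1 A h eps (x t) (y t) @[t --> \oo] --> xs.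
  have -> : (fun t => cmwu1 A h eps (x t) (y t)) = [sequence x t.+1]_t.
    by apply/funext => t; rewrite -xS.
  by rewrite cvg_shiftS.
have ycvg1 : cmwu2 A h eps (x t) (y t) @[t --> \oo] --> ys.
  have -> : (fun t => cmwu2 A h eps (x t) (y t)) = [sequence y t.+1]_t.
    by apply/funext => t; rewrite -yS.
  by rewrite cvg_shiftS.
exact: (cvg_pair xcvg1 ycvg1).
Unshelve. all: by end_near. Qed.

End Convergence.

(** * Choice of the step-size threshold [h0] *)

Theorem theorem2p5 (R : realType) (n m : nat) (A : 'M[R]_(n, m))
    (xs : 'cV[R]_n) (ys : 'cV[R]_m)
    (Hqs : quasi_strict A xs ys)
    (HA : weakly_invertible (zero_sum_space R #|supp ys|) (supp_submx A xs ys))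
    (HAT : weakly_invertible (zero_sum_space R #|supp xs|)
             (supp_submx A xs ys)^T)
    (delta C : R) (Hdelta : 0 <= delta < 1) (HC : 0 < C) :
  exists2 h0 : R, 0 < h0 &
    forall h eps : R, 0 < h < h0 -> eps = C * h `^ (- delta) ->
      (game_value A != 0 -> eps < `|(game_value A)^-1|) ->
      exists U : set ('cV[R]_n * 'cV[R]_m),
        [/\ U `<=` simplex R n `*` simplex R m,
            within (simplex R n `*` simplex R m) (nbhs (xs, ys)) U &
            forall (x : nat -> 'cV[R]_n) (y : nat -> 'cV[R]_m),
              U (x 0%N, y 0%N) ->
              (forall t, x t.+1 = cmwu1 A h eps (x t) (y t)) ->
              (forall t, y t.+1 = cmwu2 A h eps (x t) (y t)) ->
              (cmwu1 A h eps (x t) (y t), cmwu2 A h eps (x t) (y t))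
                @[t --> \oo] --> (xs, ys)].
Proof.
have /andP[d0 d1] := Hdelta.
set v := game_value A.
pose K := mx_l1 (A - const_mx v).
have K0 : 0 <= K by exact: mx_l1_ge0.
(* Chosen so that [h eps <= C / Q] forces [32 h eps K^2 <= 1]; the 1 keeps [Q] positive when
   [K = 0]. *)
pose Q := 32 * C * (K ^+ 2 + 1).
have Q0 : 0 < Q by rewrite !mulr_gt0 // ltr_wpDl ?sqr_ge0.
have KQ : 32 * C * K ^+ 2 <= Q by rewrite /Q mulrDr lerDl mulr1 mulr_ge0 ?ltW.
have d1' : 0 < 1 - delta by rewrite subr_gt0.
(* As [h eps = C h^(1 - delta)] and [1 - delta > 0], this is the step size at which
   [h eps = C / Q]. *)
pose hd := Q^-1 `^ (1 - delta)^-1.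
have hd0 : 0 < hd by rewrite powR_gt0 // invr_gt0.
(* [h <= 1] gives [eps >= C], and then [h <= C / 32] gives [32 h <= eps]; the third bound gives
   [64 h K <= 1], and [hd] bounds [h eps]. *)
pose h0 := Num.min (Num.min 1 (C / 32)) (Num.min (64 * K + 1)^-1 hd).
have K64 : 0 < 64 * K + 1 by rewrite ltr_wpDl // mulr_ge0.
exists h0.
  by rewrite !lt_min ltr01 hd0 invr_gt0 K64 divr_gt0.
move=> h eps /andP[h_gt0 hh0] epsE epsv.
have h1 : h <= 1 by rewrite (le_trans (ltW hh0)) // !ge_min lexx.
have hC : h <= C / 32 by rewrite (le_trans (ltW hh0)) // !ge_min lexx !orbT.
have hK : h <= (64 * K + 1)^-1.
  by rewrite (le_trans (ltW hh0)) // !ge_min lexx !orbT.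
have hhd : h <= hd by rewrite (le_trans (ltW hh0)) // !ge_min lexx !orbT.
have hde : 1 <= h `^ (- delta).
  have hd1 : h `^ delta <= 1 `^ delta by rewrite ge0_ler_powR // nnegrE ltW.
  rewrite powR1 in hd1; rewrite powRN -[leLHS]invr1 lef_pV2 ?posrE ?powR_gt0 //.
have Ceps : C <= eps by rewrite epsE ler_peMr // ltW.
have eps0 : 0 < eps by exact: lt_le_trans Ceps.
have heps : h * eps <= C / Q.
  have -> : h * eps = C * h `^ (1 - delta).
    rewrite powRD ?gt_eqF ?implybT // powRr1 ?ltW // epsE; ring.
  rewrite ler_pM2l //.
  have -> : Q^-1 = hd `^ (1 - delta).
    by rewrite -powRrM mulVf ?gt_eqF // powRr1 // invr_ge0 ltW.
  by apply: ge0_ler_powR => //; rewrite ?nnegrE ltW.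
have epsv1 : eps * `|v| < 1.
  have [->|v0] := eqVneq v 0; first by rewrite normr0 mulr0.
  by have := epsv v0; rewrite normfV -(ltr_pdivlMr) ?normr_gt0 // mul1r.
apply: (@cmwu_local_convergence R n m A xs ys Hqs HA HAT h eps
  (1 - eps * v) (1 + eps * v) erefl erefl h_gt0 eps0 epsv1).
- rewrite -/v -/K; have : h * (64 * K + 1) <= 1 by rewrite -ler_pdivlMr // mul1r.
  lra.
- rewrite -/v -/K.
  have : h * eps * (32 * K ^+ 2) <= C / Q * (32 * K ^+ 2).
    by rewrite ler_wpM2r // mulr_ge0 ?sqr_ge0.
  have : C / Q * (32 * K ^+ 2) <= 1.
    have -> : C / Q * (32 * K ^+ 2) = 32 * C * K ^+ 2 / Q by ring.
    by rewrite ler_pdivrMr // mul1r.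
  lra.
- lra.
Qed.
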